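(* There exists a universal constant $C>0$ such that for all integers $d_{\text{in}},d_{\text{out}}\ge1$ and all $\varepsilon>0$ there is a non-adaptive ancilla-free algorithm using incoherent measurements that is $1/3$-correct for quantum process tomography of $(d_{\text{in}},d_{\text{out}})$-dimensional quantum channels with precision $\varepsilon$ in the diamond distance, and that uses a number $N$ of measurements satisfying $$N\ \le\ C\,\frac{d_{\text{in}}^3\,d_{\text{out}}^3\,\log(d_{\text{in}}d_{\text{out}})}{\varepsilon^2}.$$
   Context: A $(d_{\text{in}},d_{\text{out}})$-dimensional quantum channel is a completely positive trace-preserving linear map $\mathcal N:\mathbb C^{d_{\text{in}}\times d_{\text{in}}}\to\mathbb C^{d_{\text{out}}\times d_{\text{out}}}$. A quantum state is a positive semi-definite matrix of trace $1$. A POVM on $\mathbb C^{D}$ is a finite family $\{M_x\}_{x\in\mathcal X}$ of positive semi-definite $D\times D$ matrices with $\sum_{x}M_x=\mathbb I$. Logarithms are natural. Diamond distance: $d_\diamond(\mathcal N,\mathcal M)=\max_\rho\|(\mathrm{id}\otimes(\mathcal N-\mathcal M))(\rho)\|_1$, where the maximum is over quantum states $\rho\in\mathbb C^{d_{\text{in}}\times d_{\text{in}}}\otimes\mathbb C^{d_{\text{in}}\times d_{\text{in}}}$ and $\|\cdot\|_1$ is the trace norm. Non-adaptive ancilla-free algorithm with $N$ incoherent measurements: before seeing any outcome, the learner fixes (possibly using internal randomness), for each $t=1,\dots,N$, an input state $\rho_t\in\mathbb C^{d_{\text{in}}\times d_{\text{in}}}$ and a POVM $\mathcal M_t=\{M^t_x\}_{x\in\mathcal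 X_t}$ on $\mathbb C^{d_{\text{out}}}$; these choices do not depend on any observed outcome. Given the unknown channel $\mathcal N$, the learner then observes outcomes $x_1,\dots,x_N$, independent conditionally on these choices, where $x_t=x$ with probability $\mathrm{Tr}\big(\mathcal N(\rho_t)M^t_{x}\big)$. From the choices and the outcomes (and possibly internal randomness) it outputs a $(d_{\text{in}},d_{\text{out}})$-dimensional quantum channel $\tilde{\mathcal N}$. The algorithm is $1/3$-correct with precision $\varepsilon$ if, for every $(d_{\text{in}},d_{\text{out}})$-dimensional quantum channel $\mathcal N$, the output satisfies $d_\diamond(\mathcal N,\tilde{\mathcal N})\le\varepsilon$ with probability at least $2/3$. *)

(* Defs.v *)
From HB Require Import structures.
From mathcomp Require Import all_boot all_order all_algebra.
From mathcomp Require Import sesquilinear spectral.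
From mathcomp Require Import all_classical all_reals all_analysis.
From mathcomp Require Import complex.
From mathcomp Require mxtens.

Set Implicit Arguments.
Unset Strict Implicit.
Unset Printing Implicit Defensive.

Import Order.TTheory GRing.Theory Num.Theory.

Local Open Scope classical_set_scope.
Local Open Scope ring_scope.
Local Open Scope sesquilinear_scope.

Section Matrices.
Variable R : realType.
Local Notation C := R[i].

(* In [R[i]], [0 <= z] says that [z] is real and nonnegative. *)
Definition psd (n : nat) (A : 'M[C]_n) : Prop :=
  A \is hermsymmx /\ forall v : 'cV[C]_n, 0 <= (v ^t* *m A *m v) 0 0.

Definition is_state (n : nat) (rho : 'M[C]_n) : Prop :=
  psd rho /\ \tr rho = 1.

Definition is_povm (n : nat) (X : finType) (M : X -> 'M[C]_n) : Prop :=
  (forall x, psd (M x)) /\ \sum_x M x = 1%:M.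

(* Sum of the singular values, i.e. the trace of the square root of A^* A.
   The eigenvalues of A^* A are real and nonnegative, so taking [Re] loses
   nothing. *)
Definition trace_norm (n : nat) (A : 'M[C]_n) : R :=
  \sum_(i < n) Num.sqrt (complex.Re (spectral_diag (A ^t* *m A) 0 i)).

(* C^k (x) C^m is indexed by pairs through [mxtens.mxtens_index], and
   (id (x) F)(Y) = \sum_(i, j) E_ij (x) F(Y_ij), with Y_ij the (i, j) block
   of Y, which for linear F is the usual tensor product. *)
Definition id_tens (k m n : nat) (F : 'M[C]_m -> 'M[C]_n)
    (Y : 'M[C]_(k * m)) : 'M[C]_(k * n) :=
  \sum_(i < k) \sum_(j < k)
    mxtens.tensmx (delta_mx i j)
      (F (\matrix_(a < m, b < m)
            Y (mxtens.mxtens_index (i, a)) (mxtens.mxtens_index (j, b)))).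

Definition completely_positive (m n : nat) (F : 'M[C]_m -> 'M[C]_n) : Prop :=
  forall (k : nat) (Y : 'M[C]_(k * m)), psd Y -> psd (id_tens F Y).

Definition trace_preserving (m n : nat) (F : 'M[C]_m -> 'M[C]_n) : Prop :=
  forall Y : 'M[C]_m, \tr (F Y) = \tr Y.

Definition is_channel (m n : nat) (F : {linear 'M[C]_m -> 'M[C]_n}) : Prop :=
  completely_positive F /\ trace_preserving F.

(* The maximum over states is written as a supremum: for m > 0 the set below is
   nonempty and the supremum is attained, by compactness. *)
Definition diamond_dist (m n : nat) (F G : 'M[C]_m -> 'M[C]_n) : R :=
  sup [set trace_norm (id_tens (k := m) (fun Y => F Y - G Y) rho)
      | rho in [set rho : 'M[C]_(m * m) | is_state rho]].

(* Measurability for the Borel sigma-algebra of the complex plane. *)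
Definition measurable_complex (d : measure_display) (W : measurableType d)
    (f : W -> C) : Prop :=
  measurable_fun [set: W] (fun w => complex.Re (f w)) /\
  measurable_fun [set: W] (fun w => complex.Im (f w)).

End Matrices.

(* A point w of the probability space W is the internal randomness of the
   learner, for the choices as well as for the final processing.  Inputs and
   measurements depend on w only, and not on outcomes.  The alphabet of the
   t-th POVM does not depend on w: alphabets are padded with zero matrices. *)
Record nonadaptive_algorithm (R : realType) (d : measure_display)
    (W : measurableType d) (din dout N : nat) := NonadaptiveAlgorithm {
  input : W -> 'I_N -> 'M[R[i]]_din ;
  alphabet : 'I_N -> finType ;
  povm : W -> forall t : 'I_N, alphabet t -> 'M[R[i]]_dout ;
  estimate : W -> {dffun forall t : 'I_N, alphabet t} ->
             {linear 'M[R[i]]_din -> 'M[R[i]]_dout} ;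
  input_state : forall w t, is_state (input w t) ;
  povmP : forall w t, is_povm (@povm w t) ;
  estimate_channel : forall w x, is_channel (estimate w x) ;
  measurable_input : forall t a b,
    measurable_complex (fun w => input w t a b) ;
  measurable_povm : forall t x a b,
    measurable_complex (fun w => @povm w t x a b) ;
  measurable_estimate : forall x Y a b,
    measurable_complex (fun w => estimate w x Y a b) }.

Arguments povm {R d W din dout N} n w t x.
Arguments estimate {R d W din dout N} n w x.

Section Success.
Variables (R : realType) (d : measure_display) (W : measurableType d).
Variables (din dout N : nat).
Variable A : @nonadaptive_algorithm R d W din dout N.

(* The trace is a nonnegative real number when F is a channel. *)
Definition outcome_prob (F : 'M[R[i]]_din -> 'M[R[i]]_dout) (w : W) (t : 'I_N)
    (x : alphabet A t) : R :=
  complex.Re (\tr (F (input A w t) *m povm A w t x)).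

Definition cond_success_prob (F : 'M[R[i]]_din -> 'M[R[i]]_dout) (eps : R)
    (w : W) : R :=
  \sum_(x : {dffun forall t : 'I_N, alphabet A t}
        | diamond_dist F (estimate A w x) <= eps)
    \prod_(t < N) outcome_prob F w (x t).

Definition success_prob (P : probability W R)
    (F : 'M[R[i]]_din -> 'M[R[i]]_dout) (eps : R) : \bar R :=
  (\int[P]_(w in [set: W]) (cond_success_prob F eps w)%:E)%E.

Definition one_third_correct (P : probability W R) (eps : R) : Prop :=
  forall F : {linear 'M[R[i]]_din -> 'M[R[i]]_dout}, is_channel F ->
    ((2 / 3 : R)%:E <= success_prob P F eps)%E.

End Success.

(* Main.v *)
(* Process tomography reduces to estimating the Choi matrix C_F of F in operator
   norm, since d_diamond(F, G) <= dout * |C_F - C_G|: for a state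
   rho = sum_k psi_k psi_k^* and a contraction U, the trace of
   U (id (x) (F - G))(rho) is a sum of values of the sesquilinear form of
   C_F - C_G at pairs of vectors whose squared norms add up to 2 dout.

   The inputs are the deterministic polarization states E_aa and
   (e_a + i^k e_b)(e_a + i^k e_b)^* / 2, from which F(E_ab) is recovered linearly.
   On each output one measures, with probability 1/2 each, the computational
   basis or the overcomplete family of vectors with entries in {1, i, -1, -i};
   the first sees the diagonal and the second the off-diagonal entries.  Because
   the sixth moments of the random-phase vectors are bounded (Khintchine), the
   unbiased estimator of u^* F(rho) v has variance at most 30 |u|^2 |v|^2, free of
   dimension factors, and is bounded by 4 dout |u| |v|.  Bernstein's inequality
   in each direction of a grid with (24 D + 1)^(2 D) points, D = din * dout,
   followed by a union bound, controls |C_F - C_G| up to eps / dout; the crude grid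
   is what costs the factor log D.  The learner outputs any channel whose Choi form
   fits the statistics at all grid points. *)

From HB Require Import structures.
Require Import Defs.
From mathcomp Require Import all_boot all_order all_algebra.
From mathcomp Require Import sesquilinear spectral.
From mathcomp Require Import all_classical all_reals all_analysis.
From mathcomp Require Import complex ring lra zify.
From mathcomp Require mxtens.

Set Implicit Arguments.
Unset Strict Implicit.
Unset Printing Implicit Defensive.

Import Order.TTheory GRing.Theory Num.Theory.
Local Open Scope ring_scope.
Local Open Scope sesquilinear_scope.
Local Notation Re := complex.Re.
Local Notation Im := complex.Im.

(** * Sesquilinear forms and a net for the operator norm *)

Section Forms.
Variable R : realType.
Local Notation C := R[i].
Implicit Types (x z : C).

(** The squared modulus, valued in [R] and not in [R[i]], so that real arithmetic applies to it
    directly. *)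
Definition sqc z : R := Re z ^+ 2 + Im z ^+ 2.

Lemma sqc_ge0 z : 0 <= sqc z.
Proof. by rewrite addr_ge0 ?sqr_ge0. Qed.

Lemma sqcM x z : sqc (x * z) = sqc x * sqc z.
Proof. by case: x => a b; case: z => c d; rewrite /sqc /=; ring. Qed.

Lemma sqc_conj z : sqc z^* = sqc z.
Proof. by case: z => a b; rewrite /sqc /= sqrrN. Qed.

Lemma sqc_le2D x z : sqc (x + z) <= 2 * (sqc x + sqc z).
Proof.
case: x => a b; case: z => c d; rewrite /sqc /=.
have := sqr_ge0 (a - c); have := sqr_ge0 (b - d); nra.
Qed.

Lemma Re_conj z : Re z^* = Re z.
Proof. by case: z. Qed.

Lemma ReM x z : Re (x * z) = Re x * Re z - Im x * Im z.
Proof. by case: x; case: z. Qed.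

Lemma ReMr (a : R) z : Re (a%:C%C * z) = a * Re z.
Proof. by rewrite ReM /= mul0r subr0. Qed.

Lemma ReD x z : Re (x + z) = Re x + Re z.
Proof. by case: x; case: z. Qed.

Lemma ReN z : Re (- z) = - Re z.
Proof. by case: z. Qed.

Lemma Re_sum (I : Type) (r : seq I) (P : pred I) (F : I -> C) :
  Re (\sum_(i <- r | P i) F i) = \sum_(i <- r | P i) Re (F i).
Proof. by rewrite raddf_sum. Qed.

Lemma Re_sqr_le z : Re z ^+ 2 <= sqc z.
Proof. by rewrite lerDl sqr_ge0. Qed.

Lemma conjM_sqc z : z^* * z = (sqc z)%:C%C.
Proof.
case: z => a b; apply/eqP; rewrite eq_complex /sqc /=.
by apply/andP; split; apply/eqP; ring.
Qed.

Lemma Re_conjM z : Re (z^* * z) = sqc z.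
Proof. by rewrite conjM_sqc. Qed.

Lemma Re_conjM_le x z : `|Re (x^* * z)| <= (sqc x + sqc z) / 2.
Proof.
case: x => a b; case: z => c d; rewrite /sqc /= ler_norml; apply/andP.
have := sqr_ge0 (a - c); have := sqr_ge0 (b - d).
by have := sqr_ge0 (a + c); have := sqr_ge0 (b + d); split; nra.
Qed.

Definition sqn (I : finType) (v : I -> C) : R := \sum_i sqc (v i).

Lemma sqn_ge0 (I : finType) (v : I -> C) : 0 <= sqn v.
Proof. by apply: sumr_ge0 => i _; apply: sqc_ge0. Qed.

Lemma sqn_parallelogram (I : finType) (u v : I -> C) :
  sqn (fun i => u i + v i) + sqn (fun i => u i - v i) = 2 * (sqn u + sqn v).
Proof.
rewrite /sqn -!big_split big_distrr /=; apply: eq_bigr => i _.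
by case: (u i) => a b; case: (v i) => c d; rewrite /sqc /=; ring.
Qed.

Lemma sqn_le2D (I : finType) (u v : I -> C) :
  sqn (fun i => u i + v i) <= 2 * (sqn u + sqn v).
Proof. by rewrite -sqn_parallelogram lerDl sqn_ge0. Qed.

Lemma sqnZ (I : finType) (a : C) (v : I -> C) :
  sqn (fun i => a * v i) = sqc a * sqn v.
Proof. by rewrite /sqn big_distrr; apply: eq_bigr => i _; rewrite sqcM. Qed.

Lemma sqc_le_sqn (I : finType) (v : I -> C) i : sqc (v i) <= sqn v.
Proof.
rewrite /sqn (bigD1 i) //= lerDl; apply: sumr_ge0 => j _; exact: sqc_ge0.
Qed.

(** Vectors are functions on an arbitrary finite type, so that the Choi form can be indexed by
    pairs. *)
Definition form (I : finType) (A : I -> I -> C) (u v : I -> C) : C :=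
  \sum_i \sum_j (u i)^* * A i j * v j.

Section Hermitian.
Variables (I : finType) (A : I -> I -> C).

Lemma formDl u u' v :
  form A (fun i => u i + u' i) v = form A u v + form A u' v.
Proof.
rewrite /form -big_split; apply: eq_bigr => i _.
by rewrite -big_split; apply: eq_bigr => j _; rewrite rmorphD !mulrDl.
Qed.

Lemma formDr u v v' :
  form A u (fun i => v i + v' i) = form A u v + form A u v'.
Proof.
rewrite /form -big_split; apply: eq_bigr => i _.
by rewrite -big_split; apply: eq_bigr => j _; rewrite mulrDr.
Qed.

Lemma formZl a u v : form A (fun i => a * u i) v = a^* * form A u v.
Proof.
rewrite /form big_distrr; apply: eq_bigr => i _; rewrite big_distrr.
by apply: eq_bigr => j _; rewrite rmorphM /= !mulrA.
Qed.

Lemma formZr a u v : form A u (fun i => a * v i) = a * form A u v.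
Proof.
rewrite /form big_distrr; apply: eq_bigr => i _; rewrite big_distrr.
by apply: eq_bigr => j _ /=; rewrite mulrCA.
Qed.

Lemma formNl u v : form A (fun i => - u i) v = - form A u v.
Proof.
rewrite /form -sumrN; apply: eq_bigr => i _; rewrite -sumrN.
by apply: eq_bigr => j _; rewrite rmorphN !mulNr.
Qed.

Lemma formNr u v : form A u (fun i => - v i) = - form A u v.
Proof.
rewrite /form -sumrN; apply: eq_bigr => i _; rewrite -sumrN.
by apply: eq_bigr => j _; rewrite mulrN.
Qed.

Hypothesis hermA : forall i j, A j i = (A i j)^*.

Lemma form_conj u v : form A v u = (form A u v)^*.
Proof.
rewrite /form exchange_big rmorph_sum; apply: eq_bigr => i _.
rewrite rmorph_sum; apply: eq_bigr => j _.
by rewrite !rmorphM /= conjCK (hermA i j); ring.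
Qed.

(** The two cross terms of a Hermitian form have equal real parts, so two of the four polarization
    terms give the real part. *)
Lemma form_polar u v : Re (form A u v) =
  (Re (form A (fun i => u i + v i) (fun i => u i + v i)) -
   Re (form A (fun i => u i - v i) (fun i => u i - v i))) / 4.
Proof.
rewrite !formDl !formDr !formNl !formNr !(ReD, ReN).
rewrite (form_conj u v) Re_conj; by field.
Qed.

Lemma form_sub_sqr u v :
  Re (form A u u) - Re (form A v v) =
  Re (form A (fun i => u i - v i) (fun i => u i + v i)).
Proof.
rewrite !formDl !formDr !formNl !(ReD, ReN) (form_conj u v) Re_conj; ring.
Qed.

(** Polarization followed by the parallelogram law. Scaling [u] up and [v] down by the same factor
    leaves the left side unchanged and can sharpen the right side. *)
Lemma form_le_AMGM (lam : R) :
    (forall v, `|Re (form A v v)| <= lam * sqn v) ->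
  forall u v, `|Re (form A u v)| <= lam * ((sqn u + sqn v) / 2).
Proof.
move=> bA u v; rewrite form_polar normrM (ger0_norm (_ : 0 <= 4^-1)) //.
apply: le_trans (_ : (lam * sqn (fun i => u i + v i) +
  lam * sqn (fun i => u i - v i)) / 4 <= _).
  by rewrite ler_wpM2r // (le_trans (ler_normB _ _)) // lerD.
by rewrite -mulrDr sqn_parallelogram le_eqVlt; apply/orP; left; apply/eqP; field.
Qed.

(** A crude entrywise bound, from [a <= (a ^ 2 + 1) / 2] for the modulus [a] of each entry. It makes
    the set of admissible constants in [form_opnorm] nonempty. *)
Lemma form_bounded : exists2 M : R, 0 <= M &
  forall v, `|Re (form A v v)| <= M * sqn v.
Proof.
exists (\sum_i \sum_j ((sqc (A i j) + 1) / 2)).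
  apply: sumr_ge0 => i _; apply: sumr_ge0 => j _.
  by rewrite divr_ge0 // addr_ge0 // sqc_ge0.
move=> v; rewrite Re_sum big_distrl /=.
apply: le_trans (ler_norm_sum _ _ _) _; apply: ler_sum => i _.
rewrite Re_sum big_distrl /=.
apply: le_trans (ler_norm_sum _ _ _) _; apply: ler_sum => j _.
have vi := sqc_le_sqn v i; have vj := sqc_le_sqn v j.
have vi0 := sqc_ge0 (v i); have vj0 := sqc_ge0 (v j); have a0 := sqc_ge0 (A i j).
rewrite -(ler_pXn2r (_ : 0 < 2)%N) ?nnegrE //; last first.
  by rewrite mulr_ge0 ?sqn_ge0 // divr_ge0 // addr_ge0.
rewrite real_normK ?num_real //; apply: le_trans (Re_sqr_le _) _.
rewrite !sqcM sqc_conj.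
have : sqc (v i) * sqc (v j) <= sqn v ^+ 2 by rewrite expr2 ler_pM.
have : sqc (A i j) <= ((sqc (A i j) + 1) / 2) ^+ 2.
  by have := sqr_ge0 (sqc (A i j) - 1); nra.
move=> h1 h2; rewrite exprMn mulrC mulrA mulrC ler_pM // ?mulr_ge0 //.
by rewrite mulrC.
Qed.

(** The infimum of the admissible constants is admissible, since for each [v] with [sqn v != 0] all
    of them lie above one and the same quotient. This replaces a maximum over the unit sphere. *)
Lemma form_opnorm : exists2 lam : R, 0 <= lam &
  (forall v, `|Re (form A v v)| <= lam * sqn v) /\
  (forall mu, 0 <= mu -> (forall v, `|Re (form A v v)| <= mu * sqn v) ->
    lam <= mu).
Proof.
pose S : set R := [set mu | 0 <= mu /\
  forall v, `|Re (form A v v)| <= mu * sqn v]%classic.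
have [M M0 MP] := form_bounded.
have S0 : (S !=set0)%classic by exists M.
have lbS : has_lbound S by exists 0 => ? [].
have lam_lb mu : S mu -> inf S <= mu by move=> ?; apply: ge_inf.
exists (inf S); first by apply: lb_le_inf => // ? [].
split => [v|mu mu0 muP]; last exact: lam_lb.
have [v0|v0] := eqVneq (sqn v) 0.
  by have := MP v; rewrite v0 !mulr0.
have vp : 0 < sqn v by rewrite lt_neqAle eq_sym v0 sqn_ge0.
rewrite -ler_pdivrMr //; apply: lb_le_inf => // mu [_ muP].
by rewrite ler_pdivrMr.
Qed.

End Hermitian.

(** * A finite grid that controls Hermitian forms *)

Section Net.
Variable I : finType.
Hypothesis I0 : (0 < #|I|)%N.
Local Notation D := (12 * #|I|)%N.

(** Numerators of the real and imaginary parts, shifted by [D] to be natural numbers. The mesh is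
    [1 / D], where [D] is twelve times the dimension. *)
Definition grid_index := {ffun I -> 'I_(2 * D).+1 * 'I_(2 * D).+1}.

Definition grid (g : grid_index) (i : I) : C :=
  Complex (((g i).1%:R - D%:R) / D%:R) (((g i).2%:R - D%:R) / D%:R).

Lemma unit_interval_round (n : nat) (x : R) : (0 < n)%N -> x ^+ 2 <= 1 ->
  exists k : 'I_(2 * n).+1, (x - (k%:R - n%:R) / n%:R) ^+ 2 <= (n%:R ^+ 2)^-1.
Proof.
move=> n0 x1; have nr0 : 0 < n%:R :> R by rewrite ltr0n.
have xl : -1 <= x by nra.
have xu : x <= 1 by nra.
have y0 : 0 <= (x + 1) * n%:R by apply: mulr_ge0; [lra | exact: ltW].
have /andP[k1 k2] := truncn_itv y0.
have kn : (Num.truncn ((x + 1) * n%:R) < (2 * n).+1)%N.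
  rewrite ltnS -(ler_nat R) (le_trans k1) // natrM ler_wpM2r //; lra.
exists (Ordinal kn) => /=; move: k1 k2; rewrite -natr1.
move: (Num.truncn _)%:R => k k1 k2.
have -> : x - (k - n%:R) / n%:R = ((x + 1) * n%:R - k) / n%:R.
  by field; rewrite gt_eqF.
rewrite expr_div_n ler_pdivrMr ?exprn_gt0 // mulVf ?expf_neq0 ?gt_eqF //.
by move: (_ * _) k1 k2 => y k1 k2; nra.
Qed.

(** With [d] for [#|I|], each of the [2 d] real coordinates costs at most [1 / (12 d) ^ 2], in total
    [1 / (72 d)]. *)
Lemma grid_dense (v : I -> C) : sqn v <= 1 ->
  exists g, sqn (fun i => v i - grid g i) <= 1 / 72.
Proof.
move=> v1; have D0 : (0 < D)%N by rewrite muln_gt0.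
have c1 i : sqc (v i) <= 1 by exact: le_trans (sqc_le_sqn v i) v1.
have h1 i : exists k : 'I_(2 * D).+1,
    (Re (v i) - (k%:R - D%:R) / D%:R) ^+ 2 <= (D%:R ^+ 2)^-1.
  by apply: unit_interval_round => //; have := c1 i; rewrite /sqc; nra.
have h2 i : exists k : 'I_(2 * D).+1,
    (Im (v i) - (k%:R - D%:R) / D%:R) ^+ 2 <= (D%:R ^+ 2)^-1.
  by apply: unit_interval_round => //; have := c1 i; rewrite /sqc; nra.
exists [ffun i => (xchoose (h1 i), xchoose (h2 i))].
apply: le_trans (_ : \sum_(i : I) 2 * (D%:R ^+ 2)^-1 <= _).
  apply: ler_sum => i _; rewrite /grid ffunE /=.
  move: (xchooseP (h1 i)) (xchooseP (h2 i)).
  move: (xchoose (h1 i)) (xchoose (h2 i)) => k l; rewrite /sqc.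
  case: (v i) => a b /= k1 k2; rewrite mulr_natl mulr2n; exact: lerD.
have -> : \sum_(i : I) 2 * (D%:R ^+ 2)^-1 =
    #|I|%:R * (2 * ((12 * #|I|%:R) ^+ 2)^-1) :> R.
  by rewrite natrM sumr_const [RHS]mulr_natl.
have : 1 <= #|I|%:R :> R by rewrite ler1n.
move: (#|I|%:R) => d d1.
have d0 : d != 0 by rewrite gt_eqF // (lt_le_trans ltr01).
have -> : d * (2 * ((12 * d) ^+ 2)^-1) = (1 / 72) * d^-1 by field.
by rewrite ler_piMr // invf_le1 // (lt_le_trans ltr01).
Qed.

(* If lam is the least constant for which the bound holds everywhere, rounding a
   unit vector to the grid costs at most lam / 2, so lam <= mu + lam / 2. *)
Lemma net_form_bound (A : I -> I -> C) (mu : R) :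
    (forall i j, A j i = (A i j)^*) -> 0 <= mu ->
    (forall g, sqn (grid g) <= 4 ->
       `|Re (form A (grid g) (grid g))| <= mu) ->
  forall v, `|Re (form A v v)| <= 2 * mu * sqn v.
Proof.
move=> hermA mu0 netA.
have [lam lam0 [lamP lam_min]] := form_opnorm A.
suff lammu : lam <= mu + lam / 2.
  move=> v; apply: le_trans (lamP v) _; rewrite ler_wpM2r ?sqn_ge0 //; lra.
apply: lam_min => [|v]; first by rewrite addr_ge0 // divr_ge0.
have unit_case u : sqn u = 1 -> `|Re (form A u u)| <= mu + lam / 2.
  move=> u1; have /grid_dense[g gP] : sqn u <= 1 by rewrite u1.
  set e := fun i => _ in gP.
  have gE : sqn (grid g) <= 4.
    have -> : sqn (grid g) = sqn (fun i => u i + - e i).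
      by congr sqn; apply/funext => i; rewrite /e opprB addrC subrK.
    apply: le_trans (sqn_le2D _ _) _; rewrite u1.
    have -> : sqn (fun i => - e i) = sqn e.
      by apply: eq_bigr => i _; rewrite /sqc; case: (e i) => a b /=; rewrite !sqrrN.
    by lra.
  have sE : sqn (fun i => u i + grid g i) <= 10.
    by apply: le_trans (sqn_le2D _ _) _; rewrite u1; lra.
  have -> : Re (form A u u) = Re (form A (grid g) (grid g)) +
      (Re (form A u u) - Re (form A (grid g) (grid g))) by ring.
  apply: le_trans (ler_normD _ _) _; apply: lerD; first exact: netA.
  rewrite form_sub_sqr // -/e.
  set s := fun i => _ in sE *.
  (* The vectors [e] and [s] have squared norms at most [1 / 72] and [10]. Scaling by [4] and
     [1 / 4] balances them: [16 / 72 + 10 / 16 < 1], so half the sum is below [1 / 2]. *)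
  have -> : form A e s =
      form A (fun i => 4%:R%:C%C * e i) (fun i => (4%:R^-1)%:C%C * s i).
    rewrite formZl formZr mulrA.
    suff -> : (4%:R%:C)%C^* * (4%:R^-1)%:C%C = 1 :> C by rewrite mul1r.
    by apply/eqP; rewrite eq_complex /= oppr0 !(mulr0, mul0r, subr0, addr0) divff ?eqxx.
  apply: le_trans (form_le_AMGM hermA lamP _ _) _.
  rewrite !sqnZ ler_wpM2l // ler_pdivrMr // mulVf //.
  by rewrite /sqc /=; lra.
have [v0|v0] := eqVneq (sqn v) 0.
  by have := lamP v; rewrite v0 !mulr0.
have vp : 0 < sqn v by rewrite lt_neqAle eq_sym v0 sqn_ge0.
set a := Num.sqrt (sqn v).
have a2 : a ^+ 2 = sqn v by rewrite sqr_sqrtr ?ltW.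
have a0 : a != 0 by rewrite gt_eqF // sqrtr_gt0.
have sqa : sqc (a^-1)%:C%C = (sqn v)^-1 by rewrite /sqc /= expr0n addr0 exprVn a2.
have := unit_case (fun i => (a^-1)%:C%C * v i).
rewrite sqnZ sqa mulVf // => /(_ erefl).
rewrite formZl formZr mulrA conjM_sqc sqa ReMr normrM gtr0_norm ?invr_gt0 //.
by rewrite mulrC ler_pdivrMr.
Qed.

End Net.
End Forms.

(** * Trace norm *)

Section TraceNorm.
Variable R : realType.
Local Notation C := R[i].

Lemma psd_form (n : nat) (A : 'M[C]_n) (v : 'I_n -> C) :
  psd A -> 0 <= form A v v.
Proof.
move=> [_ /(_ (\col_i v i))]; rewrite mxE.
congr (0 <= _); rewrite /form exchange_big; apply: eq_bigr => j _.
by rewrite !mxE big_distrl; apply: eq_bigr => i _; rewrite !mxE.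
Qed.

Lemma psd_herm (n : nat) (A : 'M[C]_n) i j : psd A -> A j i = (A i j)^*.
Proof. by move=> [/is_hermitianmxP/matrixP/(_ j i)]; rewrite !mxE expr0 mul1r. Qed.

Lemma row_sqn (n : nat) (v : 'rV[C]_n) : (v *m v^t*) 0 0 = (sqn (v 0))%:C%C.
Proof.
rewrite mxE rmorph_sum; apply: eq_bigr => i _.
by rewrite !mxE /= -conjM_sqc mulrC.
Qed.

(** The spectral theorem with real nonnegative eigenvalues: the form evaluated at the conjugate of
    row [i] of [P] is the [i]-th eigenvalue. It serves both for [psd] matrices and for the Gram
    matrix inside [trace_norm]. *)
Lemma gram_spectral (n : nat) (A : 'M[C]_n) :
    A \is hermsymmx -> (forall v : 'I_n -> C, 0 <= form A v v) ->
  let P := spectralmx A in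
  let l i := Re (spectral_diag A 0 i) in
  [/\ P *m P^t* = 1%:M, P^t* *m P = 1%:M, forall i, 0 <= l i &
    A = P^t* *m diag_mx (\row_i (l i)%:C%C) *m P].
Proof.
move=> Aherm Apos P l.
have PP : P *m P^t* = 1%:M by apply/unitarymxP/spectral_unitarymx.
have PP' : P^t* *m P = 1%:M by apply: mulmx1C.
have /orthomx_spectralP := hermitian_normalmx Aherm.
rewrite -/P (invmx_unitary (spectral_unitarymx A)) => AE.
have lE i : 0 <= spectral_diag A 0 i.
  have := Apos (fun j => (P i j)^*); congr (0 <= _).
  transitivity ((P *m A *m P^t*) i i).
    rewrite /form exchange_big mxE; apply: eq_bigr => j _.
    by rewrite !mxE big_distrl; apply: eq_bigr => k _; rewrite conjCK.
  rewrite [in LHS]AE !mulmxA PP mul1mx -mulmxA PP mulmx1.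
  by rewrite !mxE eqxx mulr1n.
have lR i : spectral_diag A 0 i = (l i)%:C%C.
  by have := lE i; rewrite lecE => /andP[/eqP h _]; apply/eqP; rewrite eq_complex h !eqxx.
split => // [i|]; first by have := lE i; rewrite lecE => /andP[].
rewrite {1}AE; congr (_ *m diag_mx _ *m _); apply/rowP => i.
by rewrite mxE lR.
Qed.

(** The rows of [B] are the eigenvectors scaled by square roots of eigenvalues. They split a state
    into pure parts, to which bounds on forms apply. *)
Lemma psd_gram (n : nat) (A : 'M[C]_n) : psd A ->
  exists B : 'I_n -> 'I_n -> C, forall i j, A i j = \sum_k (B k i)^* * B k j.
Proof.
move=> psdA; have [_ _ l0 AE] :=
  gram_spectral psdA.1 (fun v => psd_form v psdA).
exists (fun k i => (Num.sqrt (Re (spectral_diag A 0 k)))%:C%C * spectralmx A k i).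
move=> i j; rewrite [in LHS]AE mxE; apply: eq_bigr => k _.
rewrite mul_mx_diag !mxE rmorphM /=.
rewrite -{1}(sqr_sqrtr (l0 k)) rmorphXn /=.
set a := Num.sqrt _; have -> : (a%:C%C)^* = a%:C%C.
  by apply/eqP; rewrite eq_complex /= oppr0 !eqxx.
ring.
Qed.

(** One half of the duality of trace norm and operator norm: some contraction attains the trace
    norm. It turns a bound on singular values into a bound on a bilinear expression. *)
Lemma trace_norm_dual (n : nat) (X : 'M[C]_n) : exists U : 'I_n -> 'I_n -> C,
  (forall w, sqn (fun j => \sum_i w i * U i j) <= sqn w) /\
  trace_norm X = Re (\sum_i \sum_j U i j * X j i).
Proof.
set A := X^t* *m X.
have Aherm : A \is hermsymmx.
  apply/is_hermitianmxP; rewrite expr0 scale1r /A trmx_mul map_mxM /=.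
  by rewrite trmxCK.
have Apos v : 0 <= form A v v.
  suff -> : form A v v = (sqn (fun k => \sum_i X k i * v i))%:C%C.
    by rewrite ler0c sqn_ge0.
  rewrite /sqn rmorph_sum /form /=.
  transitivity (\sum_i \sum_j \sum_k (v i)^* * ((X k i)^* * X k j) * v j).
    apply: eq_bigr => i _; apply: eq_bigr => j _; rewrite mxE big_distrr big_distrl /=.
    by apply: eq_bigr => k _; rewrite !mxE.
  transitivity (\sum_i \sum_k \sum_j (v i)^* * ((X k i)^* * X k j) * v j).
    by apply: eq_bigr => i _; exact: exchange_big.
  rewrite exchange_big; apply: eq_bigr => k _.
  rewrite /= -conjM_sqc rmorph_sum big_distrl; apply: eq_bigr => i _.
  rewrite big_distrr; apply: eq_bigr => j _ /=; rewrite rmorphM /=; ring.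
have [PP PP' l0 AE] := gram_spectral Aherm Apos.
pose l i := Re (spectral_diag A 0 i).
set P := spectralmx A in PP PP' AE.
have {}l0 i : 0 <= l i by exact: l0.
have {}AE : A = P^t* *m diag_mx (\row_i (l i)%:C%C) *m P by exact: AE.
pose e i : C := ((Num.sqrt (l i))^-1)%:C%C.
pose E := diag_mx (\row_i e i).
have EE : E^t* = E.
  apply/matrixP => i j; rewrite !mxE eq_sym; case: eqVneq => [->|_].
    by rewrite !mulr1n; apply/eqP; rewrite eq_complex /= oppr0 !eqxx.
  by rewrite !mulr0n conjC0.
(* X^* X = P^* l P, so U is the pseudo-inverse of |X| times X^*, the adjoint of
   the polar part of X; the junk value 0^-1 = 0 makes E a pseudo-inverse. *)
pose U := P^t* *m E *m P *m X^t*.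
exists (fun i j => U i j); split=> [w|]; last first.
  transitivity (Re (\tr (U *m X))); last first.
    by congr Re; apply: eq_bigr => i _; rewrite mxE.
  rewrite /U -mulmxA -/A [in RHS]AE.
  rewrite !mulmxA -(mulmxA _ P) PP mulmx1 mxtrace_mulC !mulmxA PP mul1mx.
  rewrite mulmx_diag /mxtrace Re_sum; apply: eq_bigr => i _.
  rewrite -/A !mxE eqxx mulr1n /e -rmorphM /=.
  rewrite -[X in _ = _ * X](sqr_sqrtr (l0 i)).
  have [->|s0] := eqVneq (Num.sqrt (l i)) 0; first by rewrite expr0n mulr0.
  by rewrite expr2 mulKf.
pose r : 'rV[C]_n := \row_i w i.
have -> : sqn w = sqn ((r *m P^t*) 0).
  apply: complexI; rewrite -row_sqn trmx_mul map_mxM /= trmxCK.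
  rewrite mulmxA -(mulmxA r) PP' mulmx1 row_sqn; congr (_%:C)%C.
  by apply: eq_bigr => i _; rewrite mxE.
have -> : sqn (fun j => \sum_i w i * U i j) = sqn ((r *m U) 0).
  apply: eq_bigr => j _; rewrite [(r *m U) 0 j]mxE; congr sqc; apply: eq_bigr => i _.
  by congr (_ * _); rewrite mxE.
have UU : U *m U^t* = P^t* *m diag_mx (\row_i (e i * (l i)%:C%C * e i)) *m P.
  rewrite /U !trmx_mul !map_mxM /= !trmxCK EE !mulmxA.
  rewrite -(mulmxA _ _ X) -/A [in LHS]AE !mulmxA.
  rewrite -(mulmxA _ P) PP mulmx1 -(mulmxA _ P) PP mulmx1.
  congr (_ *m _); rewrite -!mulmxA !mulmx_diag; congr (_ *m diag_mx _).
  by apply/rowP => i; rewrite !mxE mulrA.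
have : (sqn ((r *m U) 0))%:C%C <= (sqn ((r *m P^t*) 0))%:C%C :> C; last by rewrite lecR.
rewrite -row_sqn trmx_mul map_mxM /= mulmxA -(mulmxA r) UU !mulmxA.
set q := r *m P^t*; rewrite -(mulmxA _ P).
have -> : P *m r^t* = q^t* by rewrite /q trmx_mul map_mxM /= trmxCK.
clearbody q; rewrite mul_mx_diag mxE /sqn rmorph_sum; apply: ler_sum => i _ /=.
rewrite !mxE mulrAC [q 0 i * _]mulrC conjM_sqc mulrC.
rewrite /e -!rmorphM lecR /= ler_piMl ?sqc_ge0 //.
rewrite -[X in _ * X * _](sqr_sqrtr (l0 i)).
have [->|s0] := eqVneq (Num.sqrt (l i)) 0; first by rewrite invr0 mulr0.
by rewrite expr2 mulKf // mulfV.
Qed.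
End TraceNorm.

(** * Diamond distance and the Choi form *)

Section Diamond.
Variable R : realType.
Local Notation C := R[i].
Local Notation idx := mxtens.mxtens_index.

Lemma big_mxtens_index (V : nmodType) (k n : nat) (f : 'I_(k * n) -> V) :
  \sum_p f p = \sum_i \sum_c f (idx (i, c)).
Proof.
rewrite pair_big /=; rewrite (reindex (@mxtens.mxtens_index k n)) /=; last first.
  exists (@mxtens.mxtens_unindex k n) => p _; first exact: mxtens.mxtens_indexK.
  exact: mxtens.mxtens_unindexK.
by apply: eq_bigr => -[].
Qed.

Definition block (k m : nat) (Y : 'M[C]_(k * m)) (i j : 'I_k) : 'M[C]_m :=
  \matrix_(a, b) Y (idx (i, a)) (idx (j, b)).

Lemma id_tensE (k m n : nat) (F : 'M[C]_m -> 'M[C]_n) (Y : 'M[C]_(k * m)) i c j e :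
  id_tens F Y (idx (i, c)) (idx (j, e)) = F (block Y i j) c e.
Proof.
rewrite /id_tens summxE (bigD1 i) //= summxE (bigD1 j) //=.
rewrite mxtens.tensmxE mxE !eqxx mul1r big1 ?addr0 => [|j' nj]; last first.
  by rewrite mxtens.tensmxE mxE eqxx [j == _]eq_sym (negPf nj) mul0r.
rewrite big1 ?addr0 // => i' ni; rewrite summxE big1 // => j' _.
by rewrite mxtens.tensmxE mxE [i == _]eq_sym (negPf ni) mul0r.
Qed.

Lemma tr_id_tens (k m n : nat) (F : 'M[C]_m -> 'M[C]_n) (Y : 'M[C]_(k * m)) :
  trace_preserving F -> \tr (id_tens F Y) = \tr Y.
Proof.
move=> trF; rewrite /mxtrace !big_mxtens_index; apply: eq_bigr => i _.
under eq_bigr do rewrite id_tensE.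
rewrite -/(\tr _) trF /mxtrace; apply: eq_bigr => a _; by rewrite mxE.
Qed.

Lemma diamond_dist_le (m n : nat) (F G : 'M[C]_m -> 'M[C]_n) (b : R) :
  0 <= b -> (forall rho : 'M[C]_(m * m), is_state rho ->
    trace_norm (id_tens (k := m) (fun Y => F Y - G Y) rho) <= b) ->
  diamond_dist F G <= b.
Proof.
move=> b0 H; rewrite /diamond_dist; set S := [set _ | _ in _]%classic.
(* There are no states when [m = 0]; the supremum of the empty set is then [0], which [0 <= b]
   covers. *)
have [->|/set0P S0] := eqVneq S set0; first by rewrite sup0.
by apply: ge_sup => // _ [rho st <-]; exact: H.
Qed.

(** In a Gram decomposition of [X], the trace of [U X] is a sum of inner products of [B k] with its
    image under the contraction, each at most [sqn (B k)] by AM-GM. *)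
Lemma contraction_psd_tr (n : nat) (X : 'M[C]_n) (U : 'I_n -> 'I_n -> C) :
    (forall w, sqn (fun j => \sum_i w i * U i j) <= sqn w) -> psd X ->
  `|Re (\sum_i \sum_j U i j * X j i)| <= Re (\tr X).
Proof.
move=> Uc /psd_gram[B XE].
have trE : Re (\tr X) = \sum_k sqn (B k).
  rewrite /mxtrace; under eq_bigr do rewrite XE.
  rewrite exchange_big Re_sum; apply: eq_bigr => k _ /=.
  by rewrite Re_sum; apply: eq_bigr => i _; rewrite Re_conjM.
have -> : \sum_i \sum_j U i j * X j i =
    \sum_k \sum_j (B k j)^* * (\sum_i B k i * U i j).
  rewrite exchange_big /= [RHS]exchange_big /=; apply: eq_bigr => j _.
  under [RHS]eq_bigr do rewrite big_distrr.
  rewrite [RHS]exchange_big /=; apply: eq_bigr => i _.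
  rewrite XE big_distrr; apply: eq_bigr => k _ /=; ring.
rewrite trE Re_sum; apply: le_trans (ler_norm_sum _ _ _) _.
apply: ler_sum => k _; rewrite Re_sum; apply: le_trans (ler_norm_sum _ _ _) _.
apply: le_trans (ler_sum _ _) _ => [j _|]; first exact: Re_conjM_le.
by rewrite -big_distrl /= big_split /= ler_pdivrMr // mulr_natr mulr2n lerD2l; exact: Uc.
Qed.

(** Both channels send the state to a positive matrix of trace 1, and a contraction sees each of
    these with modulus at most 1. *)
Lemma diamond_dist_le2 (m n : nat) (F G : {linear 'M[C]_m -> 'M[C]_n}) :
  is_channel F -> is_channel G -> diamond_dist F G <= 2.
Proof.
move=> [cpF trF] [cpG trG]; apply: diamond_dist_le => // rho [psdr trr].
have [U [Uc ->]] := trace_norm_dual (id_tens (k := m) (fun Y => F Y - G Y) rho).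
have -> : id_tens (k := m) (fun Y => F Y - G Y) rho =
    id_tens (k := m) F rho - id_tens (k := m) G rho.
  rewrite /id_tens -sumrB; apply: eq_bigr => i _.
  rewrite -sumrB; apply: eq_bigr => j _; apply/matrixP => p q.
  by rewrite !mxE mulrBr.
set X := id_tens F rho; set Y := id_tens G rho.
have hX : `|Re (\sum_i \sum_j U i j * X j i)| <= 1.
  have := contraction_psd_tr Uc (cpF _ _ psdr).
  by rewrite tr_id_tens // trr.
have hY : `|Re (\sum_i \sum_j U i j * Y j i)| <= 1.
  have := contraction_psd_tr Uc (cpG _ _ psdr).
  by rewrite tr_id_tens // trr.
clearbody X Y.
have -> : \sum_i \sum_j U i j * (X - Y) j i =
    \sum_i \sum_j U i j * X j i - \sum_i \sum_j U i j * Y j i.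
  rewrite -sumrB; apply: eq_bigr => i _; rewrite -sumrB.
  by apply: eq_bigr => j _; rewrite !mxE mulrBr.
rewrite ReD ReN; apply: le_trans (ler_norm _) _.
by apply: le_trans (ler_normB _ _) _; rewrite -[2]/(1 + 1) lerD.
Qed.

(** The unnormalized Choi matrix, with rows and columns indexed by pairs of an input and an output
    label. *)
Definition choi (m n : nat) (F : 'M[C]_m -> 'M[C]_n) (p q : 'I_m * 'I_n) : C :=
  F (delta_mx p.1 q.1) p.2 q.2.

Lemma linear_delta_sum (m n : nat) (F : {linear 'M[C]_m -> 'M[C]_n}) (Y : 'M[C]_m) c e :
  F Y c e = \sum_a \sum_b Y a b * choi F (a, c) (b, e).
Proof.
rewrite {1}(matrix_sum_delta Y) raddf_sum summxE; apply: eq_bigr => a _.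
rewrite raddf_sum summxE; apply: eq_bigr => b _.
by rewrite /= linearZ mxE.
Qed.

Lemma diamond_dist_choi_le (m n : nat) (F G : {linear 'M[C]_m -> 'M[C]_n}) (lam : R) :
    let K p q := choi F p q - choi G p q in
    (forall p q, K q p = (K p q)^*) -> 0 <= lam ->
    (forall v, `|Re (form K v v)| <= lam * sqn v) ->
  diamond_dist F G <= n%:R * lam.
Proof.
move=> K Kherm lam0 Kle; apply: diamond_dist_le; first by rewrite mulr_ge0.
move=> rho [psdr trr].
have [U [Uc ->]] := trace_norm_dual (id_tens (k := m) (fun Y => F Y - G Y) rho).
have [B rhoE] := psd_gram psdr.
have XE i c j e : id_tens (k := m) (fun Y => F Y - G Y) rho (idx (i, c)) (idx (j, e)) =
    \sum_k \sum_a \sum_b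
      (B k (idx (i, a)))^* * B k (idx (j, b)) * K (a, c) (b, e).
  rewrite id_tensE mxE [X in _ + X]mxE !linear_delta_sum -sumrB.
  rewrite [RHS]exchange_big; apply: eq_bigr => a _.
  rewrite -sumrB [RHS]exchange_big; apply: eq_bigr => b _.
  by rewrite /= -mulrBr mxE rhoE big_distrl.
(* With psi_k reshaped as an m x m matrix, the y's are the rows of psi_k (x) 1 and
   the z's are the columns of its adjoint after multiplication by U. *)
pose y k (i : 'I_m) (c : 'I_n) (p : 'I_m * 'I_n) : C :=
  if p.2 == c then B k (idx (i, p.1)) else 0.
pose z k (i : 'I_m) (c : 'I_n) (q : 'I_m * 'I_n) : C :=
  \sum_j U (idx (j, q.2)) (idx (i, c)) * B k (idx (j, q.1)).
have -> : \sum_p \sum_q U p q * id_tens (k := m) (fun Y => F Y - G Y) rho q p =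
    \sum_k \sum_i \sum_c form K (y k i c) (z k i c).
  rewrite exchange_big big_mxtens_index [RHS]exchange_big; apply: eq_bigr => i _.
  rewrite [RHS]exchange_big; apply: eq_bigr => c _ /=.
  rewrite big_mxtens_index.
  transitivity (\sum_k \sum_j \sum_e \sum_a \sum_b U (idx (j, e)) (idx (i, c)) *
    ((B k (idx (i, a)))^* * B k (idx (j, b)) * K (a, c) (b, e))).
    rewrite [RHS]exchange_big; apply: eq_bigr => j _.
    rewrite [RHS]exchange_big; apply: eq_bigr => e _.
    rewrite XE big_distrr; apply: eq_bigr => k _ /=.
    rewrite big_distrr; apply: eq_bigr => a _ /=.
    by rewrite big_distrr.
  apply: eq_bigr => k _; rewrite /form.
  transitivity (\sum_a \sum_b \sum_e \sum_j U (idx (j, e)) (idx (i, c)) *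
    ((B k (idx (i, a)))^* * B k (idx (j, b)) * K (a, c) (b, e))).
    rewrite exchange_big /=.
    rewrite (eq_bigr (fun e => \sum_a \sum_b \sum_j U (idx (j, e)) (idx (i, c)) *
      ((B k (idx (i, a)))^* * B k (idx (j, b)) * K (a, c) (b, e)))); last first.
      move=> e _; rewrite exchange_big; apply: eq_bigr => a _; exact: exchange_big.
    rewrite exchange_big; apply: eq_bigr => a _; exact: exchange_big.
  rewrite -(pair_big xpredT xpredT (fun a c' => \sum_(q : 'I_m * 'I_n)
    (y k i c (a, c'))^* * K (a, c') q * z k i c q)) /=.
  apply: eq_bigr => a _; rewrite (bigD1 c) //= [X in _ = _ + X]big1 ?addr0; last first.
    move=> c' nc; apply: big1 => q _; rewrite /y /= (negPf nc) conjC0; ring.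
  rewrite -(pair_big xpredT xpredT (fun b e =>
    (y k i c (a, c))^* * K (a, c) (b, e) * z k i c (b, e))) /=.
  apply: eq_bigr => b _; apply: eq_bigr => e _.
  rewrite /y /z eqxx big_distrr; apply: eq_bigr => j _ /=; ring.
rewrite Re_sum; apply: le_trans (_ : \sum_k \sum_i \sum_c
    lam * ((sqn (y k i c) + sqn (z k i c)) / 2) <= _).
  apply: ler_sum => k _; rewrite Re_sum; apply: ler_sum => i _.
  rewrite Re_sum; apply: ler_sum => c _.
  apply: le_trans (ler_norm _) _; exact: form_le_AMGM.
have B1 : \sum_k sqn (B k) = 1.
  have : Re (\tr rho) = 1 by rewrite trr.
  rewrite /mxtrace; under eq_bigr do rewrite rhoE.
  rewrite exchange_big Re_sum => <-; apply: eq_bigr => k _ /=.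
  by rewrite Re_sum; apply: eq_bigr => p _; rewrite Re_conjM.
have BE k : sqn (B k) = \sum_i \sum_a sqc (B k (idx (i, a))).
  by rewrite /sqn big_mxtens_index.
(* Each of the [n] output labels [c] carries one full copy of every [B k], and these have total
   squared norm 1. *)
have yE : \sum_k \sum_i \sum_c sqn (y k i c) = n%:R.
  rewrite -[RHS]mulr1 -[X in _ = _ * X]B1 big_distrr; apply: eq_bigr => k _ /=.
  rewrite BE big_distrr; apply: eq_bigr => i _ /=.
  rewrite mulr_natl -[X in _ *+ X]card_ord -sumr_const; apply: eq_bigr => c _.
  rewrite /sqn -(pair_big xpredT xpredT (fun a c' => sqc (y k i c (a, c')))) /=.
  apply: eq_bigr => a _; rewrite (bigD1 c) //= big1 ?addr0 ?/y ?eqxx // => c' nc.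
  by rewrite /= (negPf nc) /sqc /= expr0n addr0.
have zE : \sum_k \sum_i \sum_c sqn (z k i c) <= n%:R.
  rewrite -[leRHS]mulr1 -[X in _ <= _ * X]B1 big_distrr; apply: ler_sum => k _ /=.
  rewrite BE [in leRHS]exchange_big [leRHS]big_distrr /=.
  rewrite (eq_bigr (fun i => \sum_c \sum_b \sum_e sqc (z k i c (b, e)))); last first.
    move=> i _; apply: eq_bigr => c _.
    by rewrite /sqn -(pair_big xpredT xpredT (fun b e => sqc (z k i c (b, e)))).
  rewrite (eq_bigr (fun i => \sum_b \sum_e \sum_c sqc (z k i c (b, e)))); last first.
    move=> i _; rewrite exchange_big; apply: eq_bigr => b _; exact: exchange_big.
  rewrite exchange_big; apply: ler_sum => b _ /=.
  rewrite mulr_natl -[X in _ *+ X]card_ord -sumr_const.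
  rewrite exchange_big; apply: ler_sum => e _ /=.
  (* [w] is column [b] of the reshaped [B k], placed in output slot [e]. Its image under the
     contraction has the entries [z k i c (b, e)], and summing over [e] gives the factor [n]. *)
  pose w (p : 'I_(m * n)) : C := let q := mxtens.mxtens_unindex p in
    if q.2 == e then B k (idx (q.1, b)) else 0.
  have wU i c : z k i c (b, e) = \sum_p w p * U p (idx (i, c)).
    rewrite big_mxtens_index /z /=; apply: eq_bigr => j _.
    rewrite (bigD1 e) //= big1 ?addr0 => [|e' ne].
      by rewrite /w mxtens.mxtens_indexK /= eqxx mulrC.
    by rewrite /w mxtens.mxtens_indexK /= (negPf ne) mul0r.
  have -> : \sum_i \sum_c sqc (z k i c (b, e)) =
      sqn (fun q => \sum_p w p * U p q).
    rewrite /sqn big_mxtens_index; apply: eq_bigr => i _.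
    by apply: eq_bigr => c _; rewrite wU.
  apply: le_trans (Uc w) _; rewrite le_eqVlt; apply/orP; left; apply/eqP.
  rewrite /sqn big_mxtens_index; apply: eq_bigr => j _.
  rewrite (bigD1 e) //= big1 ?addr0 => [|e' ne].
    by rewrite /w mxtens.mxtens_indexK /= eqxx.
  by rewrite /w mxtens.mxtens_indexK /= (negPf ne) /sqc /= expr0n addr0.
have -> : \sum_k \sum_i \sum_c lam * ((sqn (y k i c) + sqn (z k i c)) / 2) =
    lam * ((\sum_k \sum_i \sum_c sqn (y k i c) +
            \sum_k \sum_i \sum_c sqn (z k i c)) / 2).
  do 3!(rewrite -big_split big_distrl big_distrr; apply: eq_bigr => ? _ /=).
  by [].
by rewrite yE [leRHS]mulrC ler_wpM2l // ler_pdivrMr //; lra.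
Qed.

End Diamond.

(** * Channels and probe states *)

Section Channels.
Variable R : realType.
Local Notation C := R[i].
Local Notation idx := mxtens.mxtens_index.

Lemma psdI (n : nat) (A : 'M[C]_n) :
  (forall i j, A j i = (A i j)^*) -> (forall v : 'I_n -> C, 0 <= form A v v) ->
  psd A.
Proof.
move=> hA pA; split=> [|v].
  by apply/is_hermitianmxP/matrixP => i j; rewrite !mxE expr0 mul1r -hA.
have := pA (fun i => v i 0); congr (0 <= _).
rewrite /form exchange_big mxE; apply: eq_bigr => j _.
by rewrite !mxE big_distrl; apply: eq_bigr => i _; rewrite !mxE.
Qed.

Lemma form_rank1 (I : finType) (w v : I -> C) :
  form (fun i j => w i * (w j)^*) v v = (sqc (\sum_i (w i)^* * v i))%:C%C.
Proof.
rewrite -conjM_sqc rmorph_sum big_distrl; apply: eq_bigr => i _.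
rewrite big_distrr; apply: eq_bigr => j _ /=; rewrite rmorphM /= conjCK; ring.
Qed.

(* The unnormalized maximally entangled state. *)
Definition id_block (m : nat) : 'M[C]_(m * m) :=
  let diag p : C := ((mxtens.mxtens_unindex p).1 == (mxtens.mxtens_unindex p).2 :> 'I_m)%:R in
  \matrix_(p, q) (diag p * diag q).

Lemma psd_id_block m : psd (id_block m).
Proof.
apply: psdI => [p q|v].
  by rewrite !mxE rmorphM /= !rmorph_nat mulrC.
pose w p : C := ((mxtens.mxtens_unindex p).1 == (mxtens.mxtens_unindex p).2 :> 'I_m)%:R.
suff -> : form (id_block m) v v = form (fun p q => w p * (w q)^*) v v.
  by rewrite form_rank1 ler0c sqc_ge0.
apply: eq_bigr => p _; apply: eq_bigr => q _.
by rewrite mxE /w rmorph_nat.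
Qed.

(** The Choi matrix is the image of a positive matrix under [id_tens F], so complete positivity
    makes it Hermitian and positive. *)
Lemma id_tens_id_block (m n : nat) (F : 'M[C]_m -> 'M[C]_n) i c j e :
  id_tens F (id_block m) (idx (i, c)) (idx (j, e)) = choi F (i, c) (j, e).
Proof.
rewrite id_tensE /choi /=; congr (F _ c e); apply/matrixP => a b.
by rewrite !mxE !mxtens.mxtens_indexK /= [a == i]eq_sym [b == j]eq_sym -natrM mulnb.
Qed.

Lemma choi_herm (m n : nat) (F : 'M[C]_m -> 'M[C]_n) p q :
  completely_positive F -> choi F q p = (choi F p q)^*.
Proof.
move=> /(_ m _ (psd_id_block m)) cpF; case: p q => [a c] [b e].
by rewrite -!id_tens_id_block (psd_herm _ _ cpF).
Qed.

Lemma choi_ge0 (m n : nat) (F : 'M[C]_m -> 'M[C]_n) v :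
  completely_positive F -> 0 <= form (choi F) v v.
Proof.
move=> /(_ m _ (psd_id_block m)) cpF.
have := psd_form (fun p => v (mxtens.mxtens_unindex p)) cpF; congr (0 <= _).
rewrite /form big_mxtens_index pair_big; apply: eq_bigr => -[a c] _ /=.
rewrite big_mxtens_index pair_big; apply: eq_bigr => -[b e] _ /=.
by rewrite id_tens_id_block !mxtens.mxtens_indexK.
Qed.

(** The form of [F rho] at [u] is a sum over [k] of values of the Choi form at the product vectors
    of [B k] and [u]. *)
Lemma channel_psd (m n : nat) (F : {linear 'M[C]_m -> 'M[C]_n}) rho :
  completely_positive F -> psd rho -> psd (F rho).
Proof.
move=> cpF psdr; apply: psdI => [c e|u].
  rewrite !linear_delta_sum rmorph_sum exchange_big; apply: eq_bigr => a _.
  rewrite rmorph_sum; apply: eq_bigr => b _ /=.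
  by rewrite rmorphM /= -(psd_herm _ _ psdr) -choi_herm.
have [B rhoE] := psd_gram psdr.
have -> : form (F rho) u u = \sum_k form (choi F)
    (fun p => B k p.1 * u p.2) (fun p => B k p.1 * u p.2).
  rewrite /form.
  transitivity (\sum_c \sum_e \sum_a \sum_b \sum_k
    (u c)^* * ((B k a)^* * B k b * choi F (a, c) (b, e)) * u e).
    apply: eq_bigr => c _; apply: eq_bigr => e _.
    rewrite linear_delta_sum big_distrr big_distrl; apply: eq_bigr => a _ /=.
    rewrite big_distrr big_distrl; apply: eq_bigr => b _ /=.
    by rewrite rhoE big_distrl big_distrr big_distrl.
  transitivity (\sum_k \sum_a \sum_c \sum_b \sum_e
    (u c)^* * ((B k a)^* * B k b * choi F (a, c) (b, e)) * u e); last first.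
    apply: eq_bigr => k _; rewrite pair_big; apply: eq_bigr => -[a c] _ /=.
    rewrite pair_big; apply: eq_bigr => -[b e] _ /=; rewrite rmorphM /=; ring.
  symmetry; rewrite exchange_big.
  under eq_bigr => a _ do rewrite exchange_big.
  rewrite exchange_big; apply: eq_bigr => c _ /=.
  under eq_bigr => a _ do under eq_bigr => k _ do rewrite exchange_big.
  under eq_bigr => a _ do rewrite exchange_big.
  rewrite exchange_big; apply: eq_bigr => e _ /=.
  by apply: eq_bigr => a _; rewrite exchange_big.
by apply: sumr_ge0 => k _; apply: choi_ge0.
Qed.

(** The channel that discards its input and prepares a fixed basis state. It provides a default
    output for the learner. *)
Lemma exists_channel (m n : nat) : (0 < n)%N ->
  exists F : {linear 'M[C]_m -> 'M[C]_n}, is_channel F.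
Proof.
move=> n0; pose o := Ordinal n0.
pose f (Y : 'M[C]_m) : 'M[C]_n := \tr Y *: delta_mx o o.
have flin : linear f by move=> a Y Z; rewrite /f linearP scalerDl scalerA.
pose F : {linear 'M[C]_m -> 'M[C]_n} :=
  HB.pack f (GRing.isLinear.Build _ _ _ _ f flin).
have fE Y c e : f Y c e = \tr Y * (c == o)%:R * (e == o)%:R.
  by rewrite !mxE -mulrA -natrM mulnb.
exists F; split=> [k Y psdY|Y]; last first.
  rewrite /mxtrace (bigD1 o) //= big1 ?addr0 => [|c nc]; rewrite fE.
    by rewrite eqxx !mulr1.
  by rewrite (negPf nc) !mulr0.
have blockC i j : \tr (block Y j i) = (\tr (block Y i j))^*.
  rewrite /mxtrace rmorph_sum; apply: eq_bigr => a _.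
  by rewrite !mxE /= (psd_herm _ _ psdY).
apply: psdI => [p q|v].
  case: (mxtens.mxtens_indexP p) => i c; case: (mxtens.mxtens_indexP q) => j e.
  rewrite !id_tensE !fE blockC !rmorphM /= !rmorph_nat; ring.
(* The sum over [a] of the forms of [Y] at [w a] is a partial trace of [Y] over the input factor. *)
pose w (a : 'I_m) (p : 'I_(k * m)) : C := let q := mxtens.mxtens_unindex p in
  if q.2 == a then v (idx (q.1, o)) else 0.
have -> : form (id_tens F Y) v v = \sum_a form Y (w a) (w a).
  transitivity (\sum_i \sum_j (v (idx (i, o)))^* * \tr (block Y i j) * v (idx (j, o))).
    rewrite /form big_mxtens_index; apply: eq_bigr => i _.
    rewrite (bigD1 o) //= [X in _ + X = _]big1 ?addr0 => [|c nc]; last first.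
      rewrite big_mxtens_index big1 // => j _; rewrite big1 // => e _.
      by rewrite id_tensE fE (negPf nc) !(mulr0, mul0r).
    rewrite big_mxtens_index; apply: eq_bigr => j _.
    rewrite (bigD1 o) //= big1 ?addr0 => [|e ne].
      by rewrite id_tensE fE eqxx !mulr1.
    by rewrite id_tensE fE (negPf ne) !(mulr0, mul0r).
  rewrite /form.
  transitivity (\sum_i \sum_j \sum_a (v (idx (i, o)))^* *
      Y (idx (i, a)) (idx (j, a)) * v (idx (j, o))).
    apply: eq_bigr => i _; apply: eq_bigr => j _.
    by rewrite /mxtrace big_distrr big_distrl; apply: eq_bigr => a _; rewrite mxE.
  transitivity (\sum_a \sum_i \sum_j (v (idx (i, o)))^* *
      Y (idx (i, a)) (idx (j, a)) * v (idx (j, o))).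
    rewrite [RHS]exchange_big; apply: eq_bigr => i _; exact: exchange_big.
  apply: eq_bigr => a _; rewrite big_mxtens_index; apply: eq_bigr => i _.
  rewrite (bigD1 a) //= [X in _ = _ + X]big1 ?addr0 => [|c nc]; last first.
    apply: big1 => q _; rewrite /w mxtens.mxtens_indexK /= (negPf nc) conjC0.
    by rewrite !mul0r.
  rewrite big_mxtens_index; apply: eq_bigr => j _.
  rewrite (bigD1 a) //= [X in _ = _ + X]big1 ?addr0 => [|c nc]; last first.
    by rewrite /w !mxtens.mxtens_indexK /= (negPf nc) mulr0.
  by rewrite /w !mxtens.mxtens_indexK /= eqxx.
by apply: sumr_ge0 => a _; exact: psd_form.
Qed.

Lemma big_I4 (V : nmodType) (f : C -> V) :
  \sum_(k < 4) f ('i ^+ k) = f 1 + f 'i + f (- 1) + f (- 'i).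
Proof.
rewrite !big_ord_recr big_ord0 /= add0r expr0 expr1 sqrCi.
by rewrite (exprS _ 2) sqrCi mulrN1.
Qed.

Lemma sqc_iX k : sqc ('i ^+ k : C) = 1.
Proof.
elim: k => [|k IH]; first by rewrite /sqc /= expr1n expr0n addr0.
by rewrite exprS sqcM IH /sqc /= expr1n expr0n add0r mulr1.
Qed.

Lemma conjM_iX k : ('i ^+ k : C) * ('i ^+ k)^* = 1.
Proof. by rewrite mulrC conjM_sqc sqc_iX. Qed.

(** For [a == b] the state does not depend on [k]; keeping four copies of it makes the set of
    settings a plain product. Off the diagonal [2^-1] normalizes a vector of squared norm 2. *)
Definition probe (m : nat) (a b : 'I_m) (k : nat) : 'M[C]_m :=
  if a == b then delta_mx a a else
  \matrix_(i, j) (2^-1 * (((i == a)%:R + 'i ^+ k * (i == b)%:R) *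
     ((j == a)%:R + 'i ^+ k * (j == b)%:R)^*)).

Definition probe_weight (m : nat) (a b : 'I_m) (k : nat) : C :=
  if a == b then 4^-1 else 'i ^+ k / 2.

Lemma psd_rank1 (m : nat) (A : 'M[C]_m) (s : R) (w : 'I_m -> C) :
  0 <= s -> (forall i j, A i j = s%:C%C * (w i * (w j)^*)) -> psd A.
Proof.
move=> s0 AE; apply: psdI => [i j|v].
  rewrite !AE !rmorphM /= conjCK.
  have -> : (s%:C%C)^* = s%:C%C by apply/eqP; rewrite eq_complex /= oppr0 !eqxx.
  ring.
have -> : form A v v = s%:C%C * form (fun i j => w i * (w j)^*) v v.
  rewrite /form big_distrr; apply: eq_bigr => i _.
  rewrite big_distrr; apply: eq_bigr => j _ /=; rewrite AE; ring.
by rewrite form_rank1 mulr_ge0 // ler0c // sqc_ge0.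
Qed.

Lemma is_state_rank1 (m : nat) (A : 'M[C]_m) (s : R) (w : 'I_m -> C) :
    0 <= s -> (forall i j, A i j = s%:C%C * (w i * (w j)^*)) ->
    s * sqn w = 1 ->
  is_state A.
Proof.
move=> s0 AE s1; split; first exact: psd_rank1 AE.
transitivity (s * sqn w)%:C%C; last by rewrite s1.
rewrite /sqn rmorphM rmorph_sum big_distrr; apply: eq_bigr => i _ /=.
by rewrite AE [w i * _]mulrC conjM_sqc.
Qed.

Lemma sqn_delta (m : nat) (a : 'I_m) : sqn (fun i => (i == a)%:R : C) = 1.
Proof.
rewrite /sqn (bigD1 a) //= big1 => [|i ni].
  by rewrite eqxx /sqc /= expr1n expr0n !addr0.
by rewrite (negPf ni) /sqc /= expr0n addr0.
Qed.

Lemma probe_state (m : nat) (a b : 'I_m) k : is_state (probe a b k).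
Proof.
rewrite /probe; case: eqVneq => [_|nab].
  apply: (@is_state_rank1 _ _ 1 (fun i => (i == a)%:R)) => // [i j|].
    by rewrite mxE rmorph_nat mul1r -natrM mulnb.
  by rewrite mul1r sqn_delta.
apply: (@is_state_rank1 _ _ 2^-1 (fun i => (i == a)%:R + 'i ^+ k * (i == b)%:R)) => //.
  by move=> i j; rewrite mxE; congr (_ * _); rewrite fmorphV rmorph_nat.
have -> : sqn (fun i => (i == a)%:R + 'i ^+ k * (i == b)%:R : C) = 2.
  transitivity (sqn (fun i => (i == a)%:R : C) + sqn (fun i => (i == b)%:R : C)); last first.
    by rewrite !sqn_delta.
  rewrite /sqn -big_split; apply: eq_bigr => i _ /=.
  case: (eqVneq i a) => [ia|_].
    have -> : (i == b) = false by rewrite ia; exact: negPf.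
    by rewrite mulr0 addr0 /sqc /= !expr0n !addr0.
  by rewrite !add0r sqcM sqc_iX mul1r /sqc /= !expr0n !addr0 !add0r.
by rewrite mulVf.
Qed.

(** Off the diagonal this is polarization: only the term in which ['i ^+ k] meets its conjugate
    survives, as the powers of ['i] and of [- 1] over [k < 4] sum to zero. *)
Lemma probe_recombine (m : nat) (a b : 'I_m) :
  \sum_(k < 4) probe_weight a b k *: probe a b k = delta_mx a b.
Proof.
rewrite /probe_weight /probe; case: eqVneq => [<-|nab].
  rewrite sumr_const card_ord -scaler_nat scalerA mulfV ?scale1r //.
apply/matrixP => i j; rewrite summxE !mxE.
under eq_bigr do rewrite !mxE.
rewrite (big_I4 (fun x => x / 2 * (2^-1 * (((i == a)%:R + x * (i == b)%:R) *
     ((j == a)%:R + x * (j == b)%:R)^*)))).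
rewrite -mulnb natrM.
rewrite !rmorphD !rmorphM /= !rmorph_nat !rmorphN /= conjCi rmorph1.
have ii : 'i * 'i = -1 :> C by rewrite -expr2 sqrCi.
have two : (2 : C) != 0 by rewrite pnatr_eq0.
apply: (mulfI (_ : 4 != 0 :> C)); first by rewrite pnatr_eq0.
set x := (i == a)%:R; set y := (i == b)%:R; set z := (j == a)%:R; set t := (j == b)%:R.
transitivity ((x + y) * (z + t) - (x - y) * (z - t) +
  'i * ((x + 'i * y) * (z - 'i * t) - (x - 'i * y) * (z + 'i * t))).
  by field.
transitivity (2 * x * t + 2 * y * z + ('i * 'i) * (2 * y * z - 2 * x * t)).
  by ring.
rewrite ii; ring.
Qed.

Lemma probe_weight_le m (a b : 'I_m) k : sqc (probe_weight a b k) <= 1.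
Proof.
have invE n : (n%:R^-1 : C) = (n%:R^-1 : R)%:C%C by rewrite fmorphV rmorph_nat.
rewrite /probe_weight; case: ifP => _.
  by rewrite invE /sqc /= expr0n addr0; nra.
by rewrite sqcM sqc_iX mul1r invE /sqc /= expr0n addr0; nra.
Qed.
End Channels.

(** * Moments of random-phase vectors *)

Section Moments.
Variable R : realType.
Local Notation C := R[i].
Variable n : nat.

(** Exponents of ['i], so that the alphabet is finite. Signs would not suffice: the fourth moment
    needs [phase f i ^+ 2] to average to zero. *)
Definition phases := {ffun 'I_n -> 'I_4}.

Definition phase (f : phases) (a : 'I_n) : C := 'i ^+ f a.

Definition rotate (f : phases) (o : 'I_n) (k : 'I_4) : phases :=
  [ffun a => if a == o then f a + k else f a].

Lemma phase_rotate f o k a :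
  phase (rotate f o k) a = if a == o then 'i ^+ k * phase f a else phase f a.
Proof.
rewrite /phase ffunE; case: ifP => // _.
have i4 : 'i ^+ 4 = 1 :> C.
  by rewrite -[4%N]/(2 * 2)%N exprM sqrCi sqrrN expr1n.
by rewrite /= expr_mod // exprD mulrC.
Qed.

Lemma sum_rotate (V : nmodType) (g : phases -> V) o k :
  \sum_f g f = \sum_f g (rotate f o k).
Proof.
rewrite (reindex (fun f => rotate f o k)) //.
exists (fun f => rotate f o (- k)) => f _; apply/ffunP => a;
  rewrite !ffunE; case: (a == o) => //; [exact: addrK | exact: subrK].
Qed.

(** Rotation permutes the phase vectors, so the sum equals [c] times itself. *)
Lemma sum_rotate_scale (g : phases -> C) o k (c : C) :
  c != 1 -> (forall f, g (rotate f o k) = c * g f) -> \sum_f g f = 0.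
Proof.
move=> c1 gc; have := sum_rotate g o k.
rewrite (eq_bigr _ (fun f _ => gc f)) -big_distrr /= => /eqP.
rewrite -subr_eq0 -{1}[\sum_f _]mul1r -mulrBl mulf_eq0 subr_eq0 eq_sym.
by rewrite (negPf c1) => /eqP.
Qed.

Lemma phase_conjM f a : phase f a * (phase f a)^* = 1.
Proof. exact: conjM_iX. Qed.

Lemma i_neq1 : ('i : C) != 1.
Proof. by rewrite eq_complex /= eq_sym oner_eq0. Qed.

Lemma sum_phase1 f0 : \sum_(f : phases) (f0 : C) = (4 ^ n)%:R * f0.
Proof. by rewrite sumr_const card_ffun !card_ord mulr_natl. Qed.

Lemma phase_second_moment a b :
  \sum_f phase f a * (phase f b)^* = (4 ^ n)%:R * (a == b)%:R.
Proof.
case: eqVneq => [->|nab].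
  by rewrite (eq_bigr _ (fun f _ => phase_conjM f b)) sum_phase1.
rewrite mulr0; apply: (@sum_rotate_scale _ a 1 'i); first exact: i_neq1.
by move=> f; rewrite !phase_rotate eqxx eq_sym (negPf nab) expr1 mulrA.
Qed.

(** In every other case, rotating coordinate [i] or [j] multiplies the summand by ['i], [- 1] or
    [- 'i], so the sum vanishes. *)
Lemma phase_fourth_moment k l i j : i != j ->
  \sum_f (phase f k)^* * phase f l * (phase f i * (phase f j)^*) =
    (4 ^ n)%:R * ((k == i) && (l == j))%:R.
Proof.
move=> nij; case: (boolP ((k == i) && (l == j))) => [/andP[/eqP -> /eqP ->]|].
  rewrite mulr1 -[RHS]mulr1 -sum_phase1; apply: eq_bigr => f _.
  by rewrite mulrACA [(phase f i)^* * _]mulrC !phase_conjM mulr1.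
have ii : 'i * 'i = -1 :> C by rewrite -expr2 sqrCi.
have Nn : -1 != 1 :> C by rewrite eq_sym -subr_eq0 opprK paddr_eq0 ?oner_eq0.
have in1 := i_neq1.
rewrite mulr0 negb_and; have [->|nki] := eqVneq k i => /= nlj; last first.
  have [lE|nli] := eqVneq l i.
    apply: (@sum_rotate_scale _ i 1 (-1)) => // f.
    rewrite !phase_rotate lE eqxx (negPf nki) [j == i]eq_sym (negPf nij) expr1 -ii; ring.
  apply: (@sum_rotate_scale _ i 1 'i) => // f.
  rewrite !phase_rotate eqxx (negPf nki) (negPf nli) [j == i]eq_sym (negPf nij) expr1; ring.
have [lE|nli] := eqVneq l i.
  apply: (@sum_rotate_scale _ i 1 'i) => // f.
  rewrite !phase_rotate lE eqxx [j == i]eq_sym (negPf nij) expr1 rmorphM /= conjCi.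
  rewrite -[RHS]opprK -mulNr -!mulrN.
  transitivity (- ('i * 'i) * 'i * ((phase f i)^* * phase f i * (phase f i * (phase f j)^*))).
    by ring.
  rewrite ii; ring.
apply: (@sum_rotate_scale _ j 1 (- 'i)) => [|f].
  by rewrite eqr_oppLR; rewrite eq_complex /= oppr0 eq_sym oppr_eq0 oner_eq0.
rewrite !phase_rotate eqxx (negPf nij) (negPf nlj) expr1 rmorphM /= conjCi; ring.
Qed.

Definition phase_avg (g : phases -> R) : R := (\sum_f g f) / (4 ^ n)%:R.
Local Notation avg := phase_avg.

Lemma phases_neq0 : (4 ^ n)%:R != 0 :> R.
Proof. by rewrite pnatr_eq0 expn_eq0. Qed.

Lemma avg_le g h : (forall f, g f <= h f) -> avg g <= avg h.
Proof. by move=> gh; rewrite ler_wpM2r ?invr_ge0 ?ler0n // ler_sum. Qed.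

Lemma avgD g h : avg (fun f => g f + h f) = avg g + avg h.
Proof. by rewrite /avg big_split mulrDl. Qed.

Lemma avgZ c g : avg (fun f => c * g f) = c * avg g.
Proof. by rewrite /avg -big_distrr mulrA. Qed.

Lemma avg_cst c : avg (fun=> c) = c.
Proof.
by rewrite /avg sumr_const card_ffun !card_ord -[c *+ _]mulr_natr mulfK ?phases_neq0.
Qed.

Lemma avg_sum (I : finType) (g : I -> phases -> R) :
  avg (fun f => \sum_i g i f) = \sum_i avg (g i).
Proof. by rewrite /avg exchange_big big_distrl. Qed.

Lemma avg_rotate (g : phases -> R) o :
  avg g = avg (fun f => 4^-1 * \sum_(k < 4) g (rotate f o k)).
Proof.
rewrite avgZ avg_sum (eq_bigr (fun=> avg g)) => [|k _].
  by rewrite sumr_const card_ord -[avg g *+ _]mulr_natl mulKf ?pnatr_eq0.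
by rewrite /avg -sum_rotate.
Qed.

(** The inner product of the phase vector with [z], cut off at the first [s] coordinates to allow
    induction on [s]. *)
Definition phase_psum (s : nat) (z : 'I_n -> C) (f : phases) : C :=
  \sum_(a < n | (a < s)%N) (phase f a)^* * z a.
Local Notation L := phase_psum.

Definition psqn (s : nat) (z : 'I_n -> C) : R := \sum_(a < n | (a < s)%N) sqc (z a).

Lemma psumS s z f (o : 'I_n) : o = s :> nat ->
  L s.+1 z f = L s z f + (phase f o)^* * z o.
Proof.
move=> os; rewrite /L (bigD1 o) ?os //= addrC; congr (_ + _).
apply: eq_bigl => a; rewrite ltnS ltn_neqAle andbC.
by rewrite -(inj_eq val_inj) /= os.
Qed.

Lemma psqnS s z (o : 'I_n) : o = s :> nat -> psqn s.+1 z = psqn s z + sqc (z o).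
Proof.
move=> os; rewrite /psqn (bigD1 o) ?os //= addrC; congr (_ + _).
apply: eq_bigl => a; rewrite ltnS ltn_neqAle andbC.
by rewrite -(inj_eq val_inj) /= os.
Qed.

Lemma psum_rotate s z f (o : 'I_n) k : o = s :> nat ->
  L s z (rotate f o k) = L s z f.
Proof.
move=> os; apply: eq_bigr => a; rewrite phase_rotate.
by case: eqP => // ->; rewrite os ltnn.
Qed.

Lemma psum_rotateS s z f (o : 'I_n) k : o = s :> nat ->
  L s.+1 z (rotate f o k) = L s z f + ('i ^+ k)^* * ((phase f o)^* * z o).
Proof.
move=> os; rewrite (psumS _ _ os) psum_rotate // phase_rotate eqxx.
by rewrite rmorphM /= mulrA.
Qed.

Lemma turn_sum1 (Z w : C) :
  4^-1 * \sum_(k < 4) sqc (Z + ('i ^+ k)^* * w) = sqc Z + sqc w.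
Proof.
rewrite (big_I4 (fun x => sqc (Z + x^* * w))).
rewrite !rmorphN /= rmorph1 conjCi opprK.
case: Z => a b; case: w => c d; rewrite /sqc /=; by field.
Qed.

(* The slack is |Z1 w2 - Z2 w1|^2. *)
Lemma turn_sum2 (Z1 w1 Z2 w2 : C) :
  4^-1 * \sum_(k < 4) (sqc (Z1 + ('i ^+ k)^* * w1) * sqc (Z2 + ('i ^+ k)^* * w2)) <=
  sqc Z1 * sqc Z2 + (2 * sqc w2 * sqc Z1 + (2 * sqc w1 * sqc Z2 + sqc w1 * sqc w2)).
Proof.
rewrite (big_I4 (fun x => sqc (Z1 + x^* * w1) * sqc (Z2 + x^* * w2))).
rewrite !rmorphN /= rmorph1 conjCi opprK.
rewrite -subr_ge0 (_ : _ - _ = sqc (Z1 * w2 - Z2 * w1)) ?sqc_ge0 //.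
case: Z1 w1 Z2 w2 => [a b] [c d] [a' b'] [c' d']; rewrite /sqc /=; by field.
Qed.

(** The slack is a sum of products of [sqc Z + sqc w] for one index with the squared modulus of the
    two by two determinant of the other two indices. *)
Lemma turn_sum3 (Z1 w1 Z2 w2 Z3 w3 : C) :
  4^-1 * \sum_(k < 4) (sqc (Z1 + ('i ^+ k)^* * w1) * sqc (Z2 + ('i ^+ k)^* * w2) *
    sqc (Z3 + ('i ^+ k)^* * w3)) <=
  sqc Z1 * sqc Z2 * sqc Z3 +
  (3 * sqc w1 * (sqc Z2 * sqc Z3) + (3 * sqc w2 * (sqc Z1 * sqc Z3) +
  (3 * sqc w3 * (sqc Z1 * sqc Z2) + (3 * sqc w2 * sqc w3 * sqc Z1 +
  (3 * sqc w1 * sqc w3 * sqc Z2 + (3 * sqc w1 * sqc w2 * sqc Z3 +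
   sqc w1 * sqc w2 * sqc w3)))))).
Proof.
rewrite (big_I4 (fun x => sqc (Z1 + x^* * w1) * sqc (Z2 + x^* * w2) * sqc (Z3 + x^* * w3))).
rewrite !rmorphN /= rmorph1 conjCi opprK.
rewrite -subr_ge0 (_ : _ - _ = (sqc Z1 + sqc w1) * sqc (Z2 * w3 - Z3 * w2) +
  (sqc Z2 + sqc w2) * sqc (Z1 * w3 - Z3 * w1) +
  (sqc Z3 + sqc w3) * sqc (Z1 * w2 - Z2 * w1)).
  have q0 := @sqc_ge0 R; have qD a b : 0 <= sqc a + sqc b :> R by exact: addr_ge0.
  by rewrite addr_ge0 ?mulr_ge0 // addr_ge0 ?mulr_ge0.
case: Z1 w1 Z2 w2 Z3 w3 => [a b] [c d] [a' b'] [c' d'] [a2 b2] [c2 d2].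
by rewrite /sqc /=; field.
Qed.

Lemma psqn_ge0 s z : 0 <= psqn s z.
Proof. by apply: sumr_ge0 => a _; exact: sqc_ge0. Qed.

(* Induction on the number s of summed coordinates: the sum over the whole cube is
   averaged over the rotations of coordinate s, which leave L s unchanged. *)
Lemma psum_moments s : (s <= n)%N -> forall z1 z2 z3,
  [/\ avg (fun f => sqc (L s z1 f)) = psqn s z1,
      avg (fun f => sqc (L s z1 f) * sqc (L s z2 f)) <= 2 * (psqn s z1 * psqn s z2) &
      avg (fun f => sqc (L s z1 f) * sqc (L s z2 f) * sqc (L s z3 f)) <=
        6 * (psqn s z1 * psqn s z2 * psqn s z3)].
Proof.
elim: s => [_ z1 z2 z3|s IH sn].
  have L0 z f : L 0 z f = 0 by apply: big1.
  have N0 z : psqn 0 z = 0 by apply: big1.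
  have q0 : sqc 0 = 0 :> R by rewrite /sqc /= expr0n addr0.
  rewrite !N0 !mulr0; split.
  - by under [X in avg X]funext => f do rewrite L0 q0; rewrite avg_cst.
  - by under [X in avg X]funext => f do rewrite !L0 q0 mulr0; rewrite avg_cst.
  - by under [X in avg X]funext => f do rewrite !L0 q0 mulr0; rewrite avg_cst.
have os : Ordinal sn = s :> nat by [].
have {}IH z1 z2 z3 := IH (ltnW sn) z1 z2 z3.
have wE f z : sqc ((phase f (Ordinal sn))^* * z (Ordinal sn)) = sqc (z (Ordinal sn)).
  by rewrite sqcM sqc_conj sqc_iX mul1r.
move: (Ordinal sn) os wE => o os wE z1 z2 z3.
have [m1 m12 m123] := IH z1 z2 z3; have [m2 m23 _] := IH z2 z3 z1.
have [m3 m13 _] := IH z3 z1 z2.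
have m13' : avg (fun f => sqc (L s z1 f) * sqc (L s z3 f)) <= 2 * (psqn s z1 * psqn s z3).
  by rewrite [psqn s z1 * _]mulrC; under [X in avg X]funext => f do rewrite mulrC.
have p1 := psqn_ge0 s z1; have p2 := psqn_ge0 s z2; have p3 := psqn_ge0 s z3.
have b1 := sqc_ge0 (z1 o); have b2 := sqc_ge0 (z2 o); have b3 := sqc_ge0 (z3 o).
rewrite !(psqnS _ os); split.
- rewrite (avg_rotate _ o).
  under [X in avg X]funext => f do
    (under eq_bigr do rewrite (psum_rotateS _ _ _ os); rewrite turn_sum1 wE).
  by rewrite avgD m1 avg_cst.
- rewrite (avg_rotate _ o).
  under [X in avg X]funext => f do under eq_bigr do rewrite !(psum_rotateS _ _ _ os).
  apply: le_trans (avg_le (fun f => turn_sum2 _ _ _ _)) _.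
  under [X in avg X]funext => f do rewrite !wE.
  rewrite !avgD !avgZ avg_cst m1 m2.
  move: (avg _) m12 => A; nra.
- rewrite (avg_rotate _ o).
  under [X in avg X]funext => f do under eq_bigr do rewrite !(psum_rotateS _ _ _ os).
  apply: le_trans (avg_le (fun f => turn_sum3 _ _ _ _ _ _)) _.
  under [X in avg X]funext => f do rewrite !wE.
  rewrite !avgD !avgZ avg_cst m1 m2 m3.
  move: (avg _) m123 (avg _) m23 (avg _) m13' (avg _) m12 => A mA B mB D mD E mE.
  (* The factor 3 of [turn_sum3] times the factor 2 of the moments of pairs is exactly the 6 being
     propagated. *)
  have := ler_wpM2l b1 mB; have := ler_wpM2l b2 mD; have := ler_wpM2l b3 mE.
  move: (psqn s z1) (psqn s z2) (psqn s z3) (sqc (z1 o)) (sqc (z2 o)) (sqc (z3 o))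
    p1 p2 p3 b1 b2 b3 mA {mB mD mE m1 m2 m3}.
  move=> x y z p q r x0 y0 z0 p0 q0 r0 mA h3 h2 h1.
  have g1 : 0 <= x * (q * r) by rewrite !mulr_ge0.
  have g2 : 0 <= y * (p * r) by rewrite !mulr_ge0.
  have g3 : 0 <= z * (p * q) by rewrite !mulr_ge0.
  have g4 : 0 <= p * (q * r) by rewrite !mulr_ge0.
  lra.
Qed.

End Moments.

(** * The measurement and its estimator *)

Section Measurement.
Variable R : realType.
Local Notation C := R[i].
Variable n : nat.

Lemma phase_psumE (z : 'I_n -> C) f :
  phase_psum n z f = \sum_a (phase R f a)^* * z a.
Proof. by apply: eq_bigl => a; rewrite ltn_ord. Qed.

Definition outcome := ('I_n + phases n)%type.

Definition meas (x : outcome) : 'M[C]_n :=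
  match x with
  | inl j => 2^-1 *: delta_mx j j
  | inr f => \matrix_(a, b)
      ((2^-1 / (4 ^ n)%:R : R)%:C%C * (phase R f a * (phase R f b)^*))
  end.

Lemma meas_povm : is_povm meas.
Proof.
split=> [[j|f]|].
- apply: (@psd_rank1 _ _ _ 2^-1 (fun i => (i == j)%:R)) => [//|a b].
  by rewrite !mxE fmorphV !rmorph_nat -natrM mulnb.
- apply: (@psd_rank1 _ _ _ (2^-1 / (4 ^ n)%:R) (phase R f)) => [|a b].
    by rewrite mulr_ge0 // invr_ge0 ler0n.
  by rewrite mxE.
rewrite big_sumType /=; apply/matrixP => a b; rewrite !mxE !summxE.
have -> : \sum_(j < n) (2^-1 *: delta_mx j j : 'M[C]_n) a b = 2^-1 * (a == b)%:R.
  rewrite (bigD1 a) //= big1 ?addr0 => [|j nj].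
    by rewrite !mxE eqxx eq_sym.
  by rewrite !mxE [a == j]eq_sym (negPf nj) mulr0.
under eq_bigr do rewrite mxE.
rewrite -big_distrr /= phase_second_moment mulrA rmorphM /= !fmorphV !rmorph_nat.
have T0 : (4 ^ n)%:R != 0 :> C by rewrite pnatr_eq0 expn_eq0.
have two : (2 : C) != 0 by rewrite pnatr_eq0.
by field.
Qed.

(* The phase outcome gives 2 (w w^* - 1), whose diagonal vanishes: random phases
   carry no information on the diagonal of sigma. *)
Definition est (x : outcome) (a b : 'I_n) : C :=
  match x with
  | inl j => 2 * ((a == j)%:R * (b == j)%:R)
  | inr f => 2 * (phase R f a * (phase R f b)^* - (a == b)%:R)
  end.

Section Born.
Variable sigma : 'M[C]_n.
Hypothesis sigma_state : is_state sigma.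

Definition born (x : outcome) : R := Re (\tr (sigma *m meas x)).

Lemma state_gram : exists2 B : 'I_n -> 'I_n -> C,
  (forall i j, sigma i j = \sum_k (B k i)^* * B k j) & \sum_k sqn (B k) = 1.
Proof.
have [psds trs] := sigma_state; have [B sE] := psd_gram psds; exists B => //.
have : Re (\tr sigma) = 1 by rewrite trs.
rewrite /mxtrace; under eq_bigr do rewrite sE.
rewrite exchange_big Re_sum => <-; apply: eq_bigr => k _ /=.
by rewrite Re_sum; apply: eq_bigr => p _; rewrite Re_conjM.
Qed.

Lemma born_computational j : ((born (inl j))%:C%C = 2^-1 * sigma j j /\ 0 <= born (inl j)).
Proof.
have [B sE _] := state_gram.
have bE : \tr (sigma *m meas (inl j)) = (2^-1 * \sum_k sqc (B k j))%:C%C.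
  rewrite /= -scalemxAr mxtraceZ rmorphM /= fmorphV rmorph_nat; congr (_ * _).
  rewrite /mxtrace (bigD1 j) //= big1 ?addr0 => [|i ni].
    rewrite mxE (bigD1 j) //= big1 ?addr0 => [|i ni].
      rewrite mxE !eqxx mulr1 sE rmorph_sum; apply: eq_bigr => k _ /=.
      by rewrite conjM_sqc.
    by rewrite mxE (negPf ni) mulr0.
  rewrite mxE big1 // => k _; by rewrite mxE (negPf ni) andbF mulr0.
rewrite /born bE /=; split; last first.
  by rewrite mulr_ge0 // sumr_ge0 // => k _; exact: sqc_ge0.
rewrite rmorphM /= fmorphV rmorph_nat; congr (_ * _).
by rewrite sE rmorph_sum; apply: eq_bigr => k _ /=; rewrite conjM_sqc.
Qed.

Lemma born_phase f :
  (born (inr f))%:C%C =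
    (2^-1 / (4 ^ n)%:R)%:C%C * form sigma (phase R f) (phase R f).
Proof.
have [psds _] := sigma_state.
have bE : \tr (sigma *m meas (inr f)) =
    (2^-1 / (4 ^ n)%:R)%:C%C * form sigma (phase R f) (phase R f).
  rewrite /mxtrace /form big_distrr; apply: eq_bigr => a _.
  rewrite mxE big_distrr; apply: eq_bigr => b _ /=; rewrite mxE; ring.
rewrite /born bE ReMr rmorphM /=; congr (_ * _).
have := psd_form (phase R f) psds; rewrite lecE /= => /andP[/eqP h _].
by apply/eqP; rewrite eq_complex /= h !eqxx.
Qed.

(** As a sum of squared inner products with the phase vector, the outcome law turns second moments
    of the estimator into sixth moments of phases. *)
Lemma born_phase_gram (B : 'I_n -> 'I_n -> C) f :
    (forall i j, sigma i j = \sum_k (B k i)^* * B k j) ->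
  born (inr f) =
    (2^-1 / (4 ^ n)%:R) * \sum_k sqc (phase_psum n (fun i => (B k i)^*) f).
Proof.
move=> sE; apply: complexI; rewrite born_phase [in RHS]rmorphM /=; congr (_ * _).
rewrite rmorph_sum /form.
transitivity (\sum_a \sum_b \sum_k
    (phase R f a)^* * ((B k a)^* * B k b) * phase R f b).
  apply: eq_bigr => a _; apply: eq_bigr => b _.
  by rewrite sE big_distrr big_distrl.
transitivity (\sum_k \sum_a \sum_b
    (phase R f a)^* * ((B k a)^* * B k b) * phase R f b).
  rewrite [RHS]exchange_big; apply: eq_bigr => a _; exact: exchange_big.
apply: eq_bigr => k _ /=; rewrite -conjM_sqc !phase_psumE mulrC rmorph_sum.
rewrite big_distrl; apply: eq_bigr => a _; rewrite big_distrr.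
apply: eq_bigr => b _ /=; rewrite rmorphM /= !conjCK; ring.
Qed.

Lemma born_ge0 x : 0 <= born x.
Proof.
case: x => [j|f]; first by have [] := born_computational j.
have [B sE _] := state_gram; rewrite (born_phase_gram f sE) mulr_ge0 //.
by apply: sumr_ge0 => k _; exact: sqc_ge0.
Qed.

Lemma born_sum : \sum_x born x = 1.
Proof.
have [_ trs] := sigma_state; have [_ M1] := meas_povm.
have <- : Re (\tr sigma) = 1 by rewrite trs.
rewrite -[in RHS](mulmx1 sigma) -M1 mulmx_sumr (raddf_sum (@mxtrace C n)) Re_sum.
by [].
Qed.

(** The factor 2 in [est] undoes the probability 1/2 of each measurement. Diagonal entries come from
    the computational outcomes alone, the others from [phase_fourth_moment]. *)
Lemma est_unbiased a b : \sum_x (born x)%:C%C * est x a b = sigma a b.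
Proof.
rewrite big_sumType /=.
have -> : \sum_(j < n) (born (inl j))%:C%C * (2 * ((a == j)%:R * (b == j)%:R)) =
    (a == b)%:R * sigma a b.
  rewrite (bigD1 a) //= big1 ?addr0 => [|j nj]; last first.
    by rewrite [a == j]eq_sym (negPf nj) mul0r !mulr0.
  rewrite (born_computational a).1 eqxx mul1r [b == a]eq_sym.
  case: eqVneq => [->|_]; last by rewrite !mulr0 mul0r.
  by rewrite mulr1 mul1r mulrAC mulVf ?mul1r // pnatr_eq0.
under eq_bigr do rewrite born_phase.
have [ab|nab] := eqVneq a b.
  rewrite ab big1 ?addr0 ?mul1r // => f _.
  by rewrite phase_conjM subrr !mulr0.
rewrite mul0r add0r.
transitivity (\sum_k \sum_l \sum_f ((4 ^ n)%:R^-1)%:C%C * sigma k l *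
    ((phase R f k)^* * phase R f l * (phase R f a * (phase R f b)^*))).
  transitivity (\sum_f \sum_k \sum_l ((4 ^ n)%:R^-1)%:C%C * sigma k l *
    ((phase R f k)^* * phase R f l * (phase R f a * (phase R f b)^*))).
    apply: eq_bigr => f _; rewrite subr0 /form big_distrr big_distrl.
    apply: eq_bigr => k _; rewrite big_distrr big_distrl; apply: eq_bigr => l _ /=.
    rewrite rmorphM /= [(2^-1)%:C%C]fmorphV rmorph_nat.
    have two : (2 : C) != 0 by rewrite pnatr_eq0.
    by field.
  rewrite exchange_big; apply: eq_bigr => k _; exact: exchange_big.
rewrite (bigD1 a) //= [X in _ + X]big1 ?addr0 => [|k nk]; last first.
  apply: big1 => l _; rewrite -big_distrr /= phase_fourth_moment //.
  by rewrite (negPf nk) !mulr0.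
rewrite (bigD1 b) //= [X in _ + X]big1 ?addr0 => [|l nl]; last first.
  by rewrite -big_distrr /= phase_fourth_moment // (negPf nl) andbF !mulr0.
rewrite -big_distrr /= phase_fourth_moment // !eqxx mulr1 mulrAC.
by rewrite fmorphV rmorph_nat mulVf ?mul1r // pnatr_eq0 expn_eq0.
Qed.

Lemma form_est_unbiased u v :
  \sum_x (born x)%:C%C * form (est x) u v = form sigma u v.
Proof.
rewrite /form; under eq_bigr do rewrite big_distrr /=.
rewrite exchange_big; apply: eq_bigr => a _ /=.
under eq_bigr do rewrite big_distrr /=.
rewrite exchange_big; apply: eq_bigr => b _ /=.
rewrite -est_unbiased big_distrr big_distrl; apply: eq_bigr => x _ /=; ring.
Qed.

End Born.

(** Cauchy-Schwarz: in the expanded square, AM-GM is applied to [u j * v i] against [u i * v j]. *)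
Lemma sqc_dot_le (I : finType) (u v : I -> C) :
  sqc (\sum_i (u i)^* * v i) <= sqn u * sqn v.
Proof.
rewrite -Re_conjM rmorph_sum big_distrl Re_sum /=.
apply: le_trans (_ : \sum_i \sum_j (sqc (u j) * sqc (v i) + sqc (u i) * sqc (v j)) / 2 <= _).
  apply: ler_sum => i _; rewrite big_distrr Re_sum /=; apply: ler_sum => j _.
  apply: le_trans (ler_norm _) _.
  have -> : ((u i)^* * v i)^* * ((u j)^* * v j) = (u j * v i)^* * (u i * v j).
    by rewrite !rmorphM /= conjCK; ring.
  by apply: le_trans (Re_conjM_le _ _) _; rewrite !sqcM.
rewrite le_eqVlt; apply/orP; left; apply/eqP.
transitivity ((\sum_i \sum_j sqc (u j) * sqc (v i) + \sum_i \sum_j sqc (u i) * sqc (v j)) / 2).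
  rewrite -big_split big_distrl; apply: eq_bigr => i _ /=.
  by rewrite -big_split big_distrl.
have e : \sum_i \sum_j sqc (u i) * sqc (v j) = sqn u * sqn v.
  by rewrite /sqn big_distrl; apply: eq_bigr => i _; rewrite big_distrr.
rewrite exchange_big e; by field.
Qed.

Lemma form_est_computational j u v : form (est (inl j)) u v = 2 * ((u j)^* * v j).
Proof.
rewrite /form (bigD1 j) //= [X in _ + X]big1 ?addr0 => [|a na]; last first.
  by apply: big1 => b _; rewrite /= (negPf na) mul0r !mulr0 mul0r.
rewrite (bigD1 j) //= big1 ?addr0 => [|b nb]; last first.
  by rewrite /= (negPf nb) !mulr0 mul0r.
by rewrite /= !eqxx !mulr1 mulrAC mulrC mulrA.
Qed.

Lemma form_est_phase f u v : form (est (inr f)) u v =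
  2 * ((phase_psum n u f)^* * phase_psum n v f - \sum_a (u a)^* * v a).
Proof.
rewrite !phase_psumE rmorph_sum big_distrl -sumrB big_distrr.
apply: eq_bigr => a _; rewrite big_distrr /=.
transitivity (\sum_b (2 * ((phase R f a * (u a)^*) * ((phase R f b)^* * v b)) -
    2 * ((u a)^* * ((a == b)%:R * v b)))).
  by apply: eq_bigr => b _; ring.
rewrite sumrB -!big_distrr /= (bigD1 a) //= [X in _ - 2 * (_ * X)](bigD1 a) //=.
rewrite eqxx mul1r [X in _ - 2 * (_ * (_ + X))]big1 ?addr0 => [|b nb]; last first.
  by rewrite eq_sym (negPf nb) mul0r.
by rewrite rmorphM /= conjCK mulrBr.
Qed.

Lemma sqc_form_est_phase_le f u v : sqc (form (est (inr f)) u v) <=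
  8 * (sqc (phase_psum n u f) * sqc (phase_psum n v f) + sqn u * sqn v).
Proof.
rewrite form_est_phase sqcM.
have -> : sqc 2 = 4 :> R by rewrite -(rmorph_nat (real_complex R)) /sqc /= expr0n addr0 -natrX.
apply: le_trans (_ : 4 * (2 * (sqc (phase_psum n u f) * sqc (phase_psum n v f) +
    sqn u * sqn v)) <= _); last by rewrite mulrA -natrM.
rewrite ler_wpM2l // (le_trans (sqc_le2D _ _)) // ler_wpM2l // lerD //.
  by rewrite sqcM sqc_conj.
by rewrite -mulN1r sqcM {1}/sqc /= oppr0 expr0n sqrrN expr1n addr0 mul1r sqc_dot_le.
Qed.

(** A phase vector has squared norm [n], so Cauchy-Schwarz costs [n] for each of [u] and [v]. This
    worst-case bound limits the exponent in Bernstein's inequality and leaves the variance alone. *)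
Lemma sqc_form_est_le x u v : (0 < n)%N ->
  sqc (form (est x) u v) <= 16 * n%:R ^+ 2 * (sqn u * sqn v).
Proof.
move=> n0; have n1 : 1 <= n%:R ^+ 2 :> R by rewrite exprn_ege1 // ler1n.
have P0 : 0 <= sqn u * sqn v by rewrite mulr_ge0 ?sqn_ge0.
case: x => [j|f].
  rewrite form_est_computational sqcM sqcM sqc_conj.
  have -> : sqc 2 = 4 :> R by rewrite -(rmorph_nat (real_complex R)) /sqc /= expr0n addr0 -natrX.
  have : sqc (u j) * sqc (v j) <= sqn u * sqn v by rewrite ler_pM ?sqc_ge0 ?sqc_le_sqn.
  nra.
apply: le_trans (sqc_form_est_phase_le _ _ _) _.
have pn (z : 'I_n -> C) : sqc (phase_psum n z f) <= n%:R * sqn z.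
  rewrite phase_psumE; apply: le_trans (sqc_dot_le _ _) _; rewrite /sqn.
  by under eq_bigr do rewrite sqc_iX; rewrite sumr_const card_ord.
have : sqc (phase_psum n u f) * sqc (phase_psum n v f) <= (n%:R * sqn u) * (n%:R * sqn v).
  by rewrite ler_pM ?sqc_ge0.
rewrite mulrACA -expr2; nra.
Qed.

(** Computational outcomes have total probability 1/2 and contribute [4 / 2 = 2]. Phase outcomes
    contribute [(8 / 2) * (6 + 1) = 28], with 6 from [psum_moments]. *)
Lemma est_second_moment sigma u v : is_state sigma ->
  \sum_x born sigma x * sqc (form (est x) u v) <= 30 * (sqn u * sqn v).
Proof.
move=> st; have [B sE B1] := state_gram st.
have P0 : 0 <= sqn u * sqn v by rewrite mulr_ge0 ?sqn_ge0.
rewrite big_sumType /=.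
have h1 : \sum_(j < n) born sigma (inl j) * sqc (form (est (inl j)) u v) <=
    2 * (sqn u * sqn v).
  apply: le_trans (_ : \sum_(j < n) (born sigma (inl j) * 4) * (sqn u * sqn v) <= _).
    apply: ler_sum => j _; rewrite -mulrA ler_wpM2l ?born_ge0 //.
    rewrite form_est_computational sqcM sqcM sqc_conj.
    have -> : sqc 2 = 4 :> R by rewrite -(rmorph_nat (real_complex R)) /sqc /= expr0n addr0 -natrX.
    by rewrite ler_wpM2l // ler_pM ?sqc_ge0 ?sqc_le_sqn.
  rewrite -big_distrl ler_wpM2r // -big_distrl /=.
  suff -> : \sum_(j < n) born sigma (inl j) = 2^-1 by lra.
  apply: complexI; rewrite rmorph_sum fmorphV rmorph_nat /=.
  under eq_bigr do rewrite (born_computational st _).1.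
  by rewrite -big_distrr /= -/(\tr sigma) st.2 mulr1.
have h2 : \sum_f born sigma (inr f) * sqc (form (est (inr f)) u v) <=
    28 * (sqn u * sqn v).
  pose Lk k f := sqc (phase_psum n (fun i => (B k i)^*) f).
  apply: le_trans (_ : \sum_k phase_avg (fun f =>
      4 * (Lk k f * sqc (phase_psum n u f) * sqc (phase_psum n v f)) +
      4 * (sqn u * sqn v) * Lk k f) <= _).
    rewrite -avg_sum /phase_avg big_distrl; apply: ler_sum => f _.
    rewrite (born_phase_gram st f sE) -/(Lk _ _).
    apply: le_trans (ler_wpM2l _ (sqc_form_est_phase_le _ _ _)) _.
      rewrite !mulr_ge0 ?invr_ge0 // sumr_ge0 // => k _; exact: sqc_ge0.
    rewrite le_eqVlt; apply/orP; left; apply/eqP.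
    set p := sqc (phase_psum n u f); set q := sqc (phase_psum n v f).
    have -> : \sum_k (4 * (Lk k f * p * q) + 4 * (sqn u * sqn v) * Lk k f) =
        (\sum_k Lk k f) * (4 * (p * q) + 4 * (sqn u * sqn v)).
      by rewrite [RHS]big_distrl; apply: eq_bigr => k _ /=; ring.
    move: (phases_neq0 R n); rewrite /Lk.
    move: (4 ^ n)%:R (\sum_k _) => T X T0.
    by rewrite /=; field.
  have full (z : 'I_n -> C) : psqn n z = sqn z by apply: eq_bigl => a; rewrite ltn_ord.
  apply: le_trans (_ : \sum_k 28 * (sqn u * sqn v) * sqn (B k) <= _); last first.
    by rewrite -big_distrr /= B1 mulr1.
  apply: ler_sum => k _; rewrite avgD !avgZ.
  have [m1 _ m3] := psum_moments (leqnn n) (fun i => (B k i)^*) u v.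
  have cB : psqn n (fun i => (B k i)^*) = sqn (B k).
    by rewrite full; apply: eq_bigr => i _; rewrite sqc_conj.
  rewrite m1 cB; move: m3; rewrite cB !full; move: (phase_avg _) => A mA.
  have := sqn_ge0 (B k); nra.
have -> : 30 = 2 + 28 :> R by ring.
by rewrite mulrDl lerD.
Qed.

End Measurement.

(** * Bernstein's inequality *)

Section Bernstein.
Variable R : realType.

(** From [expR x <= (1 - x)^-1], since [(1 + x + 2 x ^ 2) (1 - x) = 1 + x ^ 2 (1 - 2 x)] is at least
    1. *)
Lemma expR_le_quadratic (x : R) : `|x| <= 2^-1 -> expR x <= 1 + x + 2 * x ^+ 2.
Proof.
rewrite ler_norml => /andP[xl xu].
have h : 1 - x <= expR (- x) by exact: expR_ge1Dx.
have p : 0 < 1 - x by lra.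
rewrite -[expR x]invrK -expRN.
apply: le_trans (_ : (1 - x)^-1 <= _).
  by rewrite lef_pV2 ?posrE ?expR_gt0.
rewrite -[(1 - x)^-1]mul1r ler_pdivrMr //; nra.
Qed.

Lemma mgf_le (X : finType) (p Y : X -> R) (s : R) :
    (forall x, 0 <= p x) -> \sum_x p x = 1 ->
    (forall x, `|s * Y x| <= 2^-1) ->
  \sum_x p x * expR (s * Y x) <=
  expR (s * (\sum_x p x * Y x) + 2 * s ^+ 2 * (\sum_x p x * Y x ^+ 2)).
Proof.
move=> p0 p1 Yb; apply: le_trans (expR_ge1Dx _); rewrite -[X in _ <= X + _]p1.
rewrite !big_distrr -!big_split /=; apply: ler_sum => x _.
have := ler_wpM2l (p0 x) (expR_le_quadratic (Yb x)).
by move=> h; apply: le_trans h _; rewrite le_eqVlt; apply/orP; left; apply/eqP; ring.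
Qed.

Section Product.
Variables (T X : finType) (p : T -> X -> R).
Hypotheses (p0 : forall t x, 0 <= p t x) (p1 : forall t, \sum_x p t x = 1).

Definition joint (x : {ffun T -> X}) : R := \prod_t p t (x t).

Lemma joint_ge0 x : 0 <= joint x.
Proof. by apply: prodr_ge0. Qed.

Lemma joint_sum : \sum_x joint x = 1.
Proof. by rewrite -(bigA_distr_bigA p) big1. Qed.

(** The exponential Markov inequality: the indicator of the event is at most an exponential, whose
    mean factors over the product law. The parameter [s] is left to be optimized. *)
Lemma bernstein_upper (Y : T -> X -> R) (s delta V : R) :
    0 <= s -> (forall t x, `|s * Y t x| <= 2^-1) ->
    \sum_t \sum_x p t x * Y t x ^+ 2 <= V ->
  \sum_(x : {ffun T -> X} | delta <= \sum_t Y t (x t) - \sum_t \sum_y p t y * Y t y) joint x <=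
  expR (- (s * delta) + 2 * s ^+ 2 * V).
Proof.
move=> s0 Yb YV; set mu := \sum_t \sum_y p t y * Y t y.
apply: le_trans (_ : \sum_(x : {ffun T -> X}) expR (- (s * delta) - s * mu) *
    (joint x * \prod_t expR (s * Y t (x t))) <= _).
  rewrite big_mkcond; apply: ler_sum => x _; case: ifP => [h|_]; last first.
    by rewrite !mulr_ge0 ?expR_ge0 ?joint_ge0 // prodr_ge0 // => t _; exact: expR_ge0.
  rewrite mulrCA ler_peMr ?joint_ge0 // -expR_sum -expRD -[leLHS]expR0 ler_expR.
  rewrite -big_distrr /=; have := ler_wpM2l s0 h; rewrite mulrBr; lra.
rewrite -big_distrr /=.
have -> : \sum_(x : {ffun T -> X}) joint x * \prod_t expR (s * Y t (x t)) =
    \prod_t \sum_x p t x * expR (s * Y t x).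
  rewrite bigA_distr_bigA; apply: eq_bigr => x _.
  by rewrite /joint -big_split.
apply: le_trans (_ : expR (- (s * delta) - s * mu) *
  \prod_t expR (s * (\sum_x p t x * Y t x) +
                2 * s ^+ 2 * (\sum_x p t x * Y t x ^+ 2)) <= _).
  rewrite ler_wpM2l ?expR_ge0 // ler_prod // => t _.
  rewrite mgf_le // andbT sumr_ge0 // => x _; by rewrite mulr_ge0 ?expR_ge0.
rewrite -expR_sum -expRD ler_expR big_split -!big_distrr /= -/mu.
have h : 2 * s ^+ 2 * (\sum_t \sum_x p t x * Y t x ^+ 2) <= 2 * s ^+ 2 * V.
  by rewrite ler_wpM2l // mulr_ge0 // sqr_ge0.
lra.
Qed.

Lemma bernstein (Y : T -> X -> R) (s delta V : R) :
    0 <= s -> (forall t x, `|s * Y t x| <= 2^-1) ->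
    \sum_t \sum_x p t x * Y t x ^+ 2 <= V ->
  \sum_(x : {ffun T -> X} | delta < `|\sum_t Y t (x t) - \sum_t \sum_y p t y * Y t y|) joint x <=
  2 * expR (- (s * delta) + 2 * s ^+ 2 * V).
Proof.
move=> s0 Yb YV; rewrite mulr_natl mulr2n.
have up := bernstein_upper delta s0 Yb YV.
have lo : \sum_(x : {ffun T -> X} | delta <= \sum_t - Y t (x t) - \sum_t \sum_y p t y * - Y t y) joint x <=
    expR (- (s * delta) + 2 * s ^+ 2 * V).
  apply: (@bernstein_upper (fun t x => - Y t x)) => // [t x|].
    by rewrite mulrN normrN.
  by under eq_bigr => t _ do under eq_bigr do rewrite sqrrN.
apply: le_trans (lerD up lo); rewrite [leLHS]big_mkcond.
rewrite [X in _ <= X + _]big_mkcond [X in _ <= _ + X]big_mkcond -big_split /=.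
apply: ler_sum => x _; rewrite sumrN.
have -> : \sum_t \sum_y p t y * - Y t y = - \sum_t \sum_y p t y * Y t y.
  rewrite -sumrN; apply: eq_bigr => t _; rewrite -sumrN.
  by apply: eq_bigr => y _; rewrite mulrN.
rewrite -opprD; set z := _ - _; have J := joint_ge0 x.
case: ifP => [|_]; last by rewrite addr_ge0 //; case: ifP.
by rewrite lter_normr => /orP[] /ltW ->; [rewrite lerDl|rewrite lerDr]; case: ifP.
Qed.

End Product.
End Bernstein.

(** * The algorithm *)

Section Deterministic.
Variable R : realType.
Local Notation C := R[i].

Lemma measurable_complex_cst (d : measure_display) (W : measurableType d) (z : C) :
  measurable_complex (fun _ : W => z).
Proof. by split; exact: measurable_cst. Qed.

Lemma big_dffun (I X : finType) (P : pred {ffun I -> X}) (f : {ffun I -> X} -> R) :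
  \sum_(x : {dffun forall i : I, X} | P x) f x = \sum_(x : {ffun I -> X} | P x) f x.
Proof.
by rewrite (reindex (fun x : {ffun I -> X} => (x : {dffun forall i : I, X}))) //; exists id.
Qed.

(** Without internal randomness the probability space is one point with its Dirac mass, and the
    success probability is a finite sum. *)
Lemma deterministic_algorithm (m n N : nat) (X : finType) (inp : 'I_N -> 'M[C]_m)
    (M : X -> 'M[C]_n) (E : {ffun 'I_N -> X} -> {linear 'M[C]_m -> 'M[C]_n}) (eps : R) :
    (forall t, is_state (inp t)) -> is_povm M -> (forall x, is_channel (E x)) ->
    (forall F : {linear 'M[C]_m -> 'M[C]_n}, is_channel F ->
      2 / 3 <= \sum_(x | diamond_dist F (E x) <= eps)
        joint (fun t y => Re (\tr (F (inp t) *m M y))) x) ->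
  exists (d : measure_display) (W : measurableType d) (P : probability W R)
    (A : nonadaptive_algorithm R W m n N), one_third_correct A P eps.
Proof.
move=> inpP MP EP H.
pose A : nonadaptive_algorithm R unit m n N := {|
  input := fun _ t => inp t;
  alphabet := fun=> X;
  povm := fun _ _ => M;
  estimate := fun _ x => E x;
  input_state := fun _ t => inpP t;
  povmP := fun _ _ => MP;
  estimate_channel := fun _ x => EP x;
  measurable_input := fun t a b => measurable_complex_cst _ _;
  measurable_povm := fun t x a b => measurable_complex_cst _ _;
  measurable_estimate := fun x Y a b => measurable_complex_cst _ _ |}.
exists _, unit, (dirac tt : probability unit R), A => F Fch.
rewrite /success_prob.
have cE w : cond_success_prob A F eps w =
    \sum_(x | diamond_dist F (E x) <= eps)
        joint (fun t y => Re (\tr (F (inp t) *m M y))) x.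
  exact: (@big_dffun _ X (fun x => diamond_dist F (E x) <= eps)
     (joint (fun t y => Re (\tr (F (inp t) *m M y))))).
under eq_integral do rewrite cE.
by rewrite integral_cst //= diracT mule1 lee_fin; exact: H.
Qed.

(** A fixed channel is always a correct answer here, and the single empty record has probability
    1. *)
Lemma no_measurement (m n : nat) (eps : R) : (0 < n)%N ->
    (forall F G : {linear 'M[C]_m -> 'M[C]_n}, is_channel F -> is_channel G ->
      diamond_dist F G <= eps) ->
  exists (d : measure_display) (W : measurableType d) (P : probability W R)
    (A : nonadaptive_algorithm R W m n 0), one_third_correct A P eps.
Proof.
move=> n0 H; have [F0 F0ch] := exists_channel R m n0.
have noI (i : 'I_0) : False by case: i.
apply: (@deterministic_algorithm m n 0 (outcome n)
  (fun i => False_rect _ (noI i)) (@meas R n) (fun=> F0)) => //.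
- exact: meas_povm.
- move=> F Fch; rewrite (eq_bigl xpredT) => [|x]; last by rewrite H.
  rewrite joint_sum => [|t]; last by case: (noI t).
  by rewrite ler_pdivrMr // mul1r ler_nat.
Qed.
End Deterministic.

(** * Repeated probes, the fit of a channel and its failure probability *)

Section Tomography.
Variables (R : realType) (m n r : nat).
Local Notation C := R[i].

(** The last factor numbers the [r] repetitions of each of the [4 * m ^ 2] probes. *)
Definition setting := ('I_m * 'I_m * 'I_4 * 'I_r)%type.

Lemma big_setting (f : 'I_m -> 'I_m -> 'I_4 -> R) :
  \sum_(t : setting) f t.1.1.1 t.1.1.2 t.1.2 =
  r%:R * \sum_a \sum_b \sum_k f a b k.
Proof.
rewrite -(pair_big xpredT xpredT (fun s (j : 'I_r) => f s.1.1 s.1.2 s.2)) /=.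
rewrite (eq_bigr (fun s : 'I_m * 'I_m * 'I_4 => r%:R * f s.1.1 s.1.2 s.2)); last first.
  by move=> s _; rewrite sumr_const card_ord mulr_natl.
rewrite -big_distrr /=; congr (_ * _).
rewrite -(pair_big xpredT xpredT (fun s k => f s.1 s.2 k)) /=.
by rewrite -(pair_big xpredT xpredT (fun a b => \sum_k f a b k)).
Qed.

Definition slice (v : 'I_m * 'I_n -> C) (a : 'I_m) (c : 'I_n) : C := v (a, c).

(* Summed over all settings, an unbiased estimator of r times the Choi form at v. *)
Definition stat (v : 'I_m * 'I_n -> C) (t : setting) (y : outcome n) : R :=
  Re (probe_weight R t.1.1.1 t.1.1.2 t.1.2 *
      form (est R y) (slice v t.1.1.1) (slice v t.1.1.2)).

Definition probe_input (t : setting) : 'M[C]_m := probe R t.1.1.1 t.1.1.2 t.1.2.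

Lemma sqn_slice v : sqn v = \sum_a sqn (slice v a).
Proof. by rewrite /sqn pair_big; apply: eq_bigr => -[]. Qed.

Section Channel.
Variable F : {linear 'M[C]_m -> 'M[C]_n}.
Hypothesis Fch : is_channel F.

Lemma probe_output_state t : is_state (F (probe_input t)).
Proof.
have [psdp trp] := probe_state R t.1.1.1 t.1.1.2 t.1.2.
by have [cpF trF] := Fch; split; [exact: channel_psd | rewrite trF].
Qed.

(** Unbiasedness gives the form of [F] at each probe, and linearity with [probe_recombine]
    reassembles the blocks of the Choi matrix. *)
Lemma stat_mean v :
  \sum_t \sum_y born (F (probe_input t)) y * stat v t y =
  r%:R * Re (form (choi F) v v).
Proof.
pose f (a b : 'I_m) (k : 'I_4) := Re (probe_weight R a b k *
  form (F (probe R a b k)) (slice v a) (slice v b)).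
transitivity (\sum_(t : setting) f t.1.1.1 t.1.1.2 t.1.2).
  apply: eq_bigr => t _; rewrite /f -(form_est_unbiased (probe_output_state t)).
  rewrite big_distrr Re_sum; apply: eq_bigr => y _ /=.
  by rewrite mulrCA ReMr.
rewrite (big_setting f); congr (_ * _).
have -> : form (choi F) v v = \sum_a \sum_b form (F (delta_mx a b)) (slice v a) (slice v b).
  rewrite /form.
  transitivity (\sum_a \sum_c \sum_b \sum_e (slice v a c)^* * F (delta_mx a b) c e * slice v b e).
    rewrite [RHS]pair_big; apply: eq_bigr => -[a c] _ /=.
    by rewrite [RHS]pair_big; apply: eq_bigr => -[b e] _.
  by apply: eq_bigr => a _; exact: exchange_big.
rewrite Re_sum; apply: eq_bigr => a _; rewrite Re_sum; apply: eq_bigr => b _.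
rewrite -Re_sum -(probe_recombine R a b) (raddf_sum F); congr Re.
rewrite /form; under eq_bigr do rewrite big_distrr /=.
rewrite exchange_big; apply: eq_bigr => c _ /=.
under eq_bigr do rewrite big_distrr /=.
rewrite exchange_big; apply: eq_bigr => e _ /=.
rewrite summxE big_distrr big_distrl; apply: eq_bigr => k _ /=.
by rewrite linearZ mxE; ring.
Qed.

Lemma stat_sqr_le v t y :
  stat v t y ^+ 2 <= sqc (form (est R y) (slice v t.1.1.1) (slice v t.1.1.2)).
Proof.
apply: le_trans (Re_sqr_le _) _; rewrite sqcM ler_piMl ?sqc_ge0 //.
exact: probe_weight_le.
Qed.

(** The products of squared norms of slices sum to [sqn v ^+ 2], so no dimension factor appears:
    [1920 = 30 * 4 * 4 ^ 2], with one 4 counting the phases and [4 ^ 2] bounding [sqn v ^+ 2]. *)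
Lemma stat_second_moment v V : sqn v <= 4 -> 1920 <= V ->
  \sum_t \sum_y born (F (probe_input t)) y * stat v t y ^+ 2 <= r%:R * V.
Proof.
move=> v4 V1; apply: le_trans (_ : r%:R * 1920 <= _); last by rewrite ler_wpM2l.
apply: le_trans (_ : \sum_(t : setting)
    30 * (sqn (slice v t.1.1.1) * sqn (slice v t.1.1.2)) <= _).
  apply: ler_sum => t _; apply: le_trans (est_second_moment _ _ (probe_output_state t)).
  apply: ler_sum => y _; rewrite ler_wpM2l ?stat_sqr_le //.
  exact: born_ge0 (probe_output_state t) y.
rewrite (big_setting (fun a b k => 30 * (sqn (slice v a) * sqn (slice v b)))).
rewrite ler_wpM2l //.
rewrite (eq_bigr (fun a => 120 * sqn (slice v a) * sqn v)) => [|a _].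
  rewrite -big_distrl -big_distrr /= -sqn_slice.
  have := sqn_ge0 v; nra.
rewrite [X in _ * X]sqn_slice big_distrr; apply: eq_bigr => b _ /=.
rewrite sumr_const card_ord -mulr_natl; ring.
Qed.
End Channel.

Lemma stat_bound v t y : (0 < n)%N -> sqn v <= 4 -> `|stat v t y| <= 16 * n%:R.
Proof.
move=> n0 v4; rewrite -(ler_pXn2r (_ : 0 < 2)%N) ?nnegrE ?mulr_ge0 //.
rewrite real_normK ?num_real //; apply: le_trans (stat_sqr_le _ _ _) _.
apply: le_trans (sqc_form_est_le _ _ _ n0) _.
have s4 a : sqn (slice v a) <= 4.
  apply: le_trans v4; rewrite sqn_slice (bigD1 a) //= lerDl sumr_ge0 // => b _.
  exact: sqn_ge0.
have : sqn (slice v t.1.1.1) * sqn (slice v t.1.1.2) <= 4 * 4 by rewrite ler_pM ?sqn_ge0.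
have : 0 <= n%:R ^+ 2 :> R by rewrite sqr_ge0.
rewrite exprMn; nra.
Qed.

Local Notation N := #|{: setting}|.
Local Notation T := 'I_N.
Local Notation net := (grid_index ('I_m * 'I_n)%type).
Local Notation record := {ffun T -> outcome n}.

Lemma big_runs (f : setting -> R) : \sum_(t < N) f (enum_val t) = \sum_t f t.
Proof. by rewrite -big_enum_val. Qed.

(** The grid fills a whole cube; points with squared norm above 4 are left out, since the variance
    and range bounds on [stat] assume [sqn v <= 4]. *)
Definition consistent (delta : R) (x : record) (G : 'M[C]_m -> 'M[C]_n) : bool :=
  [forall g : net, (sqn (grid R g) <= 4) ==>
    (`|\sum_(t < N) stat (grid R g) (enum_val t) (x t) -
       r%:R * Re (form (choi G) (grid R g) (grid R g))| <= r%:R * delta)].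

(** Two channels that fit the same record differ by at most [2 * delta] at the grid points, hence by
    [4 * delta] in operator norm after [net_form_bound]. *)
Lemma consistent_diamond (delta : R) x (F G : {linear 'M[C]_m -> 'M[C]_n}) :
    (0 < m)%N -> (0 < n)%N -> (0 < r)%N -> 0 <= delta ->
    is_channel F -> is_channel G ->
    consistent delta x F -> consistent delta x G ->
  diamond_dist F G <= n%:R * (4 * delta).
Proof.
move=> m0 n0 r0 d0 [cpF _] [cpG _] /forallP cF /forallP cG.
have hK p q : choi F q p - choi G q p = (choi F p q - choi G p q)^*.
  by rewrite rmorphB /= -!choi_herm.
apply: diamond_dist_choi_le => //; first by rewrite mulr_ge0.
have -> : 4 * delta = 2 * (2 * delta) by ring.
apply: net_form_bound => [|||g g4].
- by rewrite card_prod !card_ord muln_gt0 m0.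
- by [].
- by rewrite mulr_ge0.
have /implyP/(_ g4) := cF g; have /implyP/(_ g4) := cG g.
have -> : form (fun p q => choi F p q - choi G p q) (grid R g) (grid R g) =
    form (choi F) (grid R g) (grid R g) - form (choi G) (grid R g) (grid R g).
  rewrite /form -sumrB; apply: eq_bigr => p _; rewrite -sumrB.
  by apply: eq_bigr => q _; rewrite mulrBr mulrBl.
rewrite ReD ReN; move: (\sum_t _) (Re _) (Re _) => S u v h1 h2.
have rp : 0 < r%:R :> R by rewrite ltr0n.
rewrite -(ler_pM2l rp) -[X in X * _](ger0_norm (ltW rp)) -normrM.
have -> : r%:R * (u - v) = (S - r%:R * v) - (S - r%:R * u) by ring.
apply: le_trans (ler_normB _ _) _; apply: le_trans (lerD h1 h2) _.
by rewrite le_eqVlt; apply/orP; left; apply/eqP; ring.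
Qed.

Definition run_law (F : 'M[C]_m -> 'M[C]_n) (t : T) (y : outcome n) : R :=
  born (F (probe_input (enum_val t))) y.

Lemma inconsistent_prob (delta V : R) (F : {linear 'M[C]_m -> 'M[C]_n}) :
    (0 < n)%N -> 0 <= delta -> delta * n%:R <= 1 -> 1920 <= V -> is_channel F ->
  \sum_(x | ~~ consistent delta x F) joint (run_law F) x <=
  #|{: net}|%:R * (2 * expR (- (r%:R * delta ^+ 2 / (8 * V)))).
Proof.
move=> n0 d0 dn V1 Fch.
have V0 : 0 < V := lt_le_trans (ltr0Sn _ _) V1.
have sV : 0 <= delta / (4 * V) by rewrite divr_ge0 // mulr_ge0 // ltW.
have p0 t y : 0 <= run_law F t y by exact: born_ge0 (probe_output_state Fch _) _.
have p1 t : \sum_y run_law F t y = 1 by exact: born_sum (probe_output_state Fch _).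
pose dev g (x : record) := `|\sum_(t < N) stat (grid R g) (enum_val t) (x t) -
       r%:R * Re (form (choi F) (grid R g) (grid R g))|.
apply: le_trans (_ : \sum_(x : record) \sum_(g : net)
    (if (sqn (grid R g) <= 4) && (r%:R * delta < dev g x) then joint (run_law F) x else 0) <= _).
  rewrite big_mkcond; apply: ler_sum => x _; case: ifP => [|_]; last first.
    by apply: sumr_ge0 => g _; case: ifP => // _; exact: joint_ge0.
  rewrite negb_forall => /existsP[g]; rewrite negb_imply -ltNge => gP.
  rewrite (bigD1 g) //= gP lerDl; apply: sumr_ge0 => h _.
  by case: ifP => // _; exact: joint_ge0.
rewrite exchange_big /= [leRHS]mulr_natl -sumr_const; apply: ler_sum => g _.
have [g4|_] := boolP (sqn (grid R g) <= 4); last first.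
  by rewrite /= big1 // mulr_ge0 // expR_ge0.
rewrite /= -big_mkcond /=.
have mE : \sum_(t < N) \sum_y run_law F t y * stat (grid R g) (enum_val t) y =
    r%:R * Re (form (choi F) (grid R g) (grid R g)).
  rewrite -(stat_mean Fch) -[RHS]big_runs.
  by apply: eq_bigr.
rewrite /dev -mE.
(* The choice [s = delta / (4 * V)] minimizes [- s * r * delta + 2 * s ^ 2 * r * V]. As
   [delta * n <= 1], the exponents [s * stat] stay below [4 / V <= 1 / 2]. *)
apply: le_trans (@bernstein _ _ _ _ p0 p1 (fun t y => stat (grid R g) (enum_val t) y)
  (delta / (4 * V)) (r%:R * delta) (r%:R * V) _ _ _) _.
- exact: sV.
- move=> t y; rewrite normrM (ger0_norm sV).
  apply: le_trans (ler_wpM2l sV (stat_bound _ _ n0 g4)) _.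
  by rewrite mulrAC ler_pdivrMr ?mulr_gt0 //; nra.
- have := stat_second_moment Fch g4 V1.
  by rewrite -[X in X <= _ -> _](big_runs (fun t =>
    \sum_y born (F (probe_input t)) y * stat (grid R g) t y ^+ 2)).
- rewrite ler_wpM2l // ler_expR le_eqVlt; apply/orP; left; apply/eqP.
  by field; rewrite gt_eqF.
Qed.

Lemma tomography (delta V eps : R) :
    (0 < m)%N -> (0 < n)%N -> (0 < r)%N -> 0 <= delta -> delta * n%:R <= 1 -> 1920 <= V ->
    n%:R * (4 * delta) <= eps ->
    #|{: net}|%:R * (2 * expR (- (r%:R * delta ^+ 2 / (8 * V)))) <= 1 / 3 ->
  exists (d : measure_display) (W : measurableType d) (P : probability W R)
    (A : nonadaptive_algorithm R W m n N), one_third_correct A P eps.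
Proof.
move=> m0 n0 r0 d0 dn V1 de fail; have [F0 F0ch] := exists_channel R m n0.
(* A channel that fits the record if there is one, and the default otherwise. If the true channel
   fits, the chosen one does too. *)
have ex (x : record) : exists G : {linear 'M[C]_m -> 'M[C]_n}, is_channel G /\
    ((exists2 F : {linear 'M[C]_m -> 'M[C]_n}, is_channel F & consistent delta x F) ->
     consistent delta x G).
  have [[F Fch cF]|no] := pselect (exists2 F : {linear 'M[C]_m -> 'M[C]_n},
      is_channel F & consistent delta x F); first by exists F.
  by exists F0.
have [E EP] := choice ex.
apply: (@deterministic_algorithm _ m n N (outcome n)
  (fun t => probe_input (enum_val t)) (@meas R n) E).
- by move=> t; exact: probe_state.
- exact: meas_povm.
- by move=> x; have [] := EP x.
move=> F Fch.
have p0 t y : 0 <= run_law F t y by exact: born_ge0 (probe_output_state Fch _) _.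
have p1 t : \sum_y run_law F t y = 1 by exact: born_sum (probe_output_state Fch _).
have good x : consistent delta x F -> diamond_dist F (E x) <= eps.
  move=> cF; have [Ech Ec] := EP x; apply: le_trans de.
  by apply: (consistent_diamond (x := x)) => //; apply: Ec; exists F.
have := joint_sum p1; rewrite (bigID (fun x => consistent delta x F)) /=.
have := inconsistent_prob n0 d0 dn V1 Fch.
move: (\sum_(x | ~~ _) _) => bad badP sum1.
apply: le_trans (_ : \sum_(x | consistent delta x F) joint (run_law F) x <= _).
  by move: sum1; move: (\sum_(x | _) _) => s; lra.
rewrite [leLHS]big_mkcond [leRHS]big_mkcond; apply: ler_sum => x _.
case: ifP => [/good ->//|_]; case: ifP => // _; exact: (joint_ge0 p0).
Qed.

End Tomography.

(** * Sample size *)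

Section SampleSize.
Variable R : realType.

(** The bounds [24 D + 1 <= 32 D <= D ^ 6] give [D ^ (12 D)] grid points, and [6 <= 2 ^ (3 D)]
    accounts for the rest of the exponent 15. The 6 absorbs the two tails and the failure level
    1/3. *)
Lemma card_net (I : finType) : (2 <= #|I|)%N ->
  (6 * #|{: grid_index I}| <= #|I| ^ (15 * #|I|))%N.
Proof.
rewrite card_ffun card_prod !card_ord; move: #|I| => D D2.
have D6 : ((2 * (12 * D)).+1 <= D ^ 6)%N.
  apply: leq_trans (_ : D * 2 ^ 5 <= _)%N; first by lia.
  by rewrite [leqRHS]expnS leq_mul2l leq_exp2r // D2 orbT.
rewrite -[15%N]/(3 + 12)%N mulnDl expnD; apply: leq_mul.
  apply: leq_trans (_ : 2 ^ (3 * D) <= _)%N; last by rewrite leq_exp2r //; lia.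
  by apply: leq_trans (_ : 2 ^ 3 <= _)%N; rewrite // leq_exp2l //; lia.
rewrite expnM leq_exp2r; last by lia.
by rewrite -[12%N]/(6 + 6)%N expnD leq_mul.
Qed.

Lemma ln2_ge : 2^-1 <= ln 2 :> R.
Proof.
have := expR_ge1Dx (- ln 2 : R); rewrite expRN lnK ?posrE // => h; lra.
Qed.

Lemma expR_lnMn (D k : nat) : (0 < D)%N -> expR (k%:R * ln D%:R) = D%:R ^+ k :> R.
Proof. by move=> D0; rewrite mulr_natl -lnXn ?ltr0n // lnK // posrE exprn_gt0 ?ltr0n. Qed.

Lemma net_failure (I : finType) (y : R) : (2 <= #|I|)%N ->
  (15 * #|I|)%:R * ln #|I|%:R <= y ->
  #|{: grid_index I}|%:R * (2 * expR (- y)) <= 1 / 3.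
Proof.
move=> I2 hy; rewrite expRN; have e0 := expR_gt0 y.
have : (6 * #|{: grid_index I}|)%:R <= expR y :> R.
  apply: le_trans (_ : expR ((15 * #|I|)%:R * ln #|I|%:R) <= _); last by rewrite ler_expR.
  by rewrite expR_lnMn ?(leq_trans _ I2) // -natrX ler_nat card_net.
rewrite natrM => h; rewrite mulrA ler_pdivrMr //; lra.
Qed.

End SampleSize.

Theorem theorem3p3 (R : realType) :
  exists C : R, 0 < C /\
    forall (din dout : nat) (eps : R),
      (1 <= din)%N -> (1 <= dout)%N -> 0 < eps ->
      exists (N : nat) (d : measure_display) (W : measurableType d)
             (P : probability W R) (A : nonadaptive_algorithm R W din dout N),
        one_third_correct A P eps /\
        N%:R <= C * (din%:R ^+ 3 * dout%:R ^+ 3 * ln (din%:R * dout%:R))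
                / eps ^+ 2.
Proof.
(* Only the lower bound on [V] is kept, so the numeral stays out of later computations. *)
have [V V1] : exists V : R, 1920 <= V by exists 1920.
have V0 : 0 < V := lt_le_trans (ltr0Sn _ _) V1.
have Vge1 : 1 <= V by apply: le_trans V1; rewrite ler1n.
(* 15 comes from the size of the net, one 8 from Bernstein's exponent, the other from four phases
   and the rounding of [r] up to [2 * x], and 16 from [delta ^+ 2]. *)
exists (15 * 8 * 8 * 16 * V); split; first by rewrite !mulr_gt0.
move=> m n eps m0 n0 eps0.
have ln0 : 0 <= ln (m%:R * n%:R) :> R by rewrite ln_ge0 // -natrM ler1n muln_gt0 m0.
have rhs0 : 0 <= 15 * 8 * 8 * 16 * V * (m%:R ^+ 3 * n%:R ^+ 3 * ln (m%:R * n%:R)) / eps ^+ 2.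
  by rewrite !mulr_ge0 ?invr_ge0 ?exprn_ge0 ?ler0n // ltW.
have trivial_case : (forall F G : {linear 'M[R[i]]_m -> 'M[R[i]]_n},
    is_channel F -> is_channel G -> diamond_dist F G <= eps) ->
  exists (N : nat) (d : measure_display) (W : measurableType d)
    (P : probability W R) (A : nonadaptive_algorithm R W m n N),
    one_third_correct A P eps /\
    N%:R <= 15 * 8 * 8 * 16 * V * (m%:R ^+ 3 * n%:R ^+ 3 * ln (m%:R * n%:R)) / eps ^+ 2.
  move=> /(no_measurement n0)[d [W [P [A AP]]]].
  by exists 0%N, d, W, P, A.
(* For large [eps] the bound on [N] falls below 1, so no measurement may be made and any channel has
   to do. *)
have [eps2|eps2] := leP 2 eps.
  by apply: trivial_case => F G Fch Gch; apply: le_trans (diamond_dist_le2 Fch Gch) eps2.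
(* When both dimensions are 1 the logarithm vanishes and forces [N = 0]; preservation of the trace
   then leaves a single channel. *)
have [mn1|mn2] := leqP (m * n) 1.
  have m1 : m = 1%N.
    by apply/eqP; rewrite eqn_leq m0 andbT (leq_trans _ mn1) // leq_pmulr.
  have n1 : n = 1%N.
    by apply/eqP; rewrite eqn_leq n0 andbT (leq_trans _ mn1) // leq_pmull.
  apply: trivial_case => F G [cpF trF] [cpG trG]; subst m n.
  have K0 p q : choi F p q - choi G p q = 0.
    have tr1 (X : 'M[R[i]]_1) : \tr X = X 0 0 by rewrite /mxtrace big_ord1.
    rewrite /choi (ord1 p.2) (ord1 q.2) -!tr1 trF trG subrr //.
  apply: le_trans (@diamond_dist_choi_le _ _ _ F G 0 _ _ _) _ => //.
  - by move=> p q; rewrite !K0 conjC0.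
  - move=> v; rewrite mul0r /form big1 ?normr0 // => p _; rewrite big1 // => q _.
    by rewrite K0 mulr0 mul0r.
  - by rewrite mulr0 ltW.
have mp : 0 < m%:R :> R by rewrite ltr0n.
have np : 0 < n%:R :> R by rewrite ltr0n.
have n1 : 1 <= n%:R :> R by rewrite ler1n.
pose D := #|{: 'I_m * 'I_n}|.
have DE : D = (m * n)%N by rewrite /D card_prod !card_ord.
pose delta := eps / (4 * n%:R).
have d0 : 0 < delta by rewrite divr_gt0 // mulr_gt0.
(* The real number of repetitions at which Bernstein's exponent equals the exponent 15 D ln D
   required by [net_failure]. *)
pose x := (15 * D)%:R * ln D%:R * (8 * V) / delta ^+ 2.
have lnD : 2^-1 <= ln D%:R :> R.
  apply: le_trans (ln2_ge R) _; rewrite ler_ln ?posrE ?ltr0n ?ler_nat ?DE //.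
  by apply: leq_trans mn2.
(* This makes the rounded value [r], which lies between [x] and [x + 1], at most [2 * x]. *)
have x1 : 1 <= x.
  rewrite /x ler_pdivlMr ?exprn_gt0 // mul1r.
  have d1 : delta <= 1.
    by rewrite /delta ler_pdivrMr ?mulr_gt0 // mul1r; lra.
  have D30 : 2 <= (15 * D)%:R :> R by rewrite ler_nat DE (leq_trans mn2) // leq_pmull.
  have h1 : 1 <= (15 * D)%:R * ln D%:R :> R.
    by rewrite -[leLHS](@mulfV _ 2) // ler_pM.
  have h2 : 1 * 1 <= (15 * D)%:R * ln D%:R * (8 * V) by rewrite ler_pM //; lra.
  by apply: le_trans h2; rewrite mul1r expr_le1 // ltW.
have x0 : 0 <= x by lra.
have /andP[rl ru] := truncn_itv x0.
pose r := (Num.truncn x).+1.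
have r2 : r%:R <= 2 * x by rewrite /r -natr1; lra.
have [|||||d [W [P [A AP]]]] := @tomography R m n r delta V eps m0 n0 isT.
- exact: ltW.
- by rewrite /delta mulrAC ler_pdivrMr ?mulr_gt0 //; nra.
- exact: V1.
- by rewrite /delta le_eqVlt; apply/orP; left; apply/eqP; field; rewrite gt_eqF.
- apply: net_failure; first by rewrite -/D DE.
  rewrite -/D ler_pdivlMr ?mulr_gt0 // -ler_pdivrMr ?exprn_gt0 //.
  exact: ltW.
exists _, d, W, P, A; split=> //.
rewrite /setting !card_prod !card_ord !natrM.
apply: le_trans (_ : m%:R * m%:R * 4 * (2 * x) <= _).
  by rewrite ler_wpM2l // !mulr_ge0.
rewrite /x /delta DE !natrM le_eqVlt; apply/orP; left; apply/eqP.
by field; rewrite !gt_eqF.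
Qed.
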